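(* Let $(X^*,X_*,R,\check R)$ be an irreducible (reduced) root system of rank $\ge4$ which is not of type $A_{n-1}$. Then $\mathrm{Adm}(\mu)\ne\mathrm{Perm}(\mu)$ for every sufficiently regular dominant coweight $\mu\in X_*$; that is, there is a constant $N$ depending only on the root system such that $\mathrm{Adm}(\mu)\neq\mathrm{Perm}(\mu)$ for every $\mu\in X_*$ with $\langle\alpha,\mu\rangle\ge N$ for all simple roots $\alpha$.
   Context: Root data: $(X^*,X_*,R,\check R)$ is a reduced and irreducible root system: $X^*,X_*$ are free abelian groups of finite rank, dual under a perfect pairing $\langle\ ,\ \rangle:X^*\times X_*\to\mathbb Z$, with roots $R\subset X^*$ and coroots $\check R\subset X_*$. Fix a base $\Pi$ (the simple roots), with positive roots $R^+$ and highest root $\tilde\alpha$; the rank of $R$ is $|\Pi|$. Let $V=X_*\otimes\mathbb R$. $W_0$ is the finite Weyl group, generated by the reflections $s_\alpha(x)=x-\langle\alpha,x\rangle\check\alpha$. A coweight is an element of $X_*$; $\mu\in X_*$ is dominant if $\langle\alpha,\mu\rangle\ge0$ for all $\alpha\in\Pi$. Affine Weyl groups: for $\alpha\in R$, $k\in\mathbb Z$, let $s_{\alpha,k}(x)=x-(\langle\alpha,x\rangle-k)\check\alpha$, with fixed hyperplane $H_{\alpha,k}$. $W_{\rm aff}$ is the group generated by all $s_{\alpha,k}$; it is a Coxeter group with generators $S_{\rm aff}=\{s_\alpha:\alpha\in\Pi\}\cup\{s_{\tilde\alpha,1}\}$. Alcoves are the connected components of $V-\bigcup_{\alpha\in R,k\in\mathbb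 Z}H_{\alpha,k}$; the base alcove is $A_0=\{x\in V:\langle\alpha,x\rangle>0\ \forall\alpha\in\Pi,\ \langle\tilde\alpha,x\rangle<1\}$. The extended affine Weyl group $\widetilde W=X_*\rtimes W_0$ ($\lambda\in X_*$ acting as the translation $t_\lambda$) acts on alcoves; $\Omega$ is the stabilizer of $A_0$ in $\widetilde W$, and $\widetilde W=W_{\rm aff}\rtimes\Omega$. The Bruhat order extends to $\widetilde W$: for $w,w'\in W_{\rm aff}$, $\tau,\tau'\in\Omega$, $w\tau\le w'\tau'$ iff $w\le w'$ in the Bruhat order of $(W_{\rm aff},S_{\rm aff})$ and $\tau=\tau'$. A vertex of $A_0$ is any point of a facet of minimal dimension of the closure of $A_0$ (a vertex in the usual sense if $R$ spans $X^*\otimes\mathbb R$; in general the condition below does not depend on the choice of the point in the facet). Admissible and permissible sets: for $\mu$ dominant let $\tau\in\Omega$ be the unique element with $t_\mu\in W_{\rm aff}\tau$, and let $\mathrm{Conv}(\mu)$ be the convex hull in $V$ of $W_0(\mu)$. Then $\mathrm{Adm}(\mu)=\{x\in\widetilde W: x\le t_\lambda\text{ for some }\lambda\in W_0(\mu)\}$, and $\mathrm{Perm}(\mu)$ is the set of $x\in W_{\rm aff}\tau$ such that $x(a)-a\in\mathrm{Conv}(\mu)$ for every vertex $a$ of $A_0$. *)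

(* Defs.v *)
From HB Require Import structures.
From mathcomp Require Import all_boot all_order all_algebra.
From mathcomp Require Import all_classical all_reals all_analysis.

Set Implicit Arguments.
Unset Strict Implicit.
Unset Printing Implicit Defensive.

Import Order.TTheory GRing.Theory Num.Theory.
Import numFieldNormedType.Exports.

Local Open Scope classical_set_scope.
Local Open Scope ring_scope.

(* A perfect pairing between free abelian groups of rank n is, after the choice
   of a basis of X_* and of the dual basis of X^*, the standard pairing on
   Z^n x Z^n.  Hence X^*, X_* are 'rV[int]_n, and V = X_* (x) R is 'rV[R]_n. *)
Definition pairing (A : pzRingType) (n : nat) (a x : 'rV[A]_n) : A :=
  \sum_(i < n) a 0 i * x 0 i.

(* [coroot] is meaningful only on [roots]; the set of coroots is its image. *)
Record root_datum (n : nat) := RootDatum {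
  roots : seq 'rV[int]_n;
  coroot : 'rV[int]_n -> 'rV[int]_n;
  coroot_inj : {in roots &, injective coroot};
  pairing_coroot : forall a, a \in roots -> pairing a (coroot a) = 2;
  root_reflection : forall a b, a \in roots -> b \in roots ->
    b - pairing b (coroot a) *: a \in roots;
  coroot_reflection : forall a b, a \in roots -> b \in roots ->
    coroot b - pairing a (coroot b) *: coroot a \in map coroot roots
}.

Definition reduced (n : nat) (D : root_datum n) : Prop :=
  forall a b (p q : int), a \in roots D -> b \in roots D ->
    p != 0 -> p *: a = q *: b -> b = a \/ b = - a.

Definition irreducible (n : nat) (D : root_datum n) : Prop :=
  (exists a, a \in roots D) /\
  ~ exists P : pred 'rV[int]_n,
      [/\ exists2 a, a \in roots D & P a,
          exists2 b, b \in roots D & ~~ P b &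
          forall a b, a \in roots D -> b \in roots D -> P a -> ~~ P b ->
            pairing a (coroot D b) = 0].

Definition nonneg_comb (n : nat) (Pi : seq 'rV[int]_n) (v : 'rV[int]_n) : Prop :=
  exists c : 'rV[int]_n -> nat, v = \sum_(a <- Pi) a *+ c a.

Definition is_base (n : nat) (D : root_datum n) (Pi : seq 'rV[int]_n) : Prop :=
  [/\ uniq Pi,
      {subset Pi <= roots D},
      (forall c : 'rV[int]_n -> int,
         \sum_(a <- Pi) c a *: a = 0 -> forall a, a \in Pi -> c a = 0) &
      (forall b, b \in roots D -> nonneg_comb Pi b \/ nonneg_comb Pi (- b))].

Definition is_highest_root (n : nat) (D : root_datum n)
    (Pi : seq 'rV[int]_n) (h : 'rV[int]_n) : Prop :=
  h \in roots D /\ forall b, b \in roots D -> nonneg_comb Pi (h - b).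

(* Type A_m with m = size Pi: some ordering of the simple roots has the Cartan
   matrix of A_m. *)
Definition is_type_A (n : nat) (D : root_datum n) (Pi : seq 'rV[int]_n) : Prop :=
  exists2 s : seq 'rV[int]_n, perm_eq s Pi &
    forall i j, (i < size s)%N -> (j < size s)%N ->
      pairing (nth 0 s i) (coroot D (nth 0 s j)) =
        if i == j then 2
        else if (i.+1 == j) || (j.+1 == i) then -1 else 0.

(* Groups of bijections of T and Coxeter-theoretic notions, relative to a set S
   of bijections. *)
Inductive generated (T : Type) (S : set (T -> T)) : (T -> T) -> Prop :=
| generated_id : generated S id
| generated_in f : S f -> generated S f
| generated_comp f g : generated S f -> generated S g -> generated S (f \o g)
| generated_inv f g : generated S f -> cancel f g -> cancel g f ->
    generated S g.

Inductive has_word (T : Type) (S : set (T -> T)) : nat -> (T -> T) -> Prop :=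
| word_nil : has_word S 0 id
| word_cons k s w : S s -> has_word S k w -> has_word S k.+1 (s \o w).

Definition has_length (T : Type) (S : set (T -> T)) (w : T -> T) (k : nat) : Prop :=
  has_word S k w /\ forall j, has_word S j w -> (k <= j)%N.

Definition reflection (T : Type) (S : set (T -> T)) (t : T -> T) : Prop :=
  exists f g s, [/\ generated S f, cancel f g, cancel g f, S s & t = f \o s \o g].

(* Bruhat order: u <= w iff there is a chain from u to w in which each step is
   the multiplication by a reflection and increases the length. *)
Inductive bruhat (T : Type) (S : set (T -> T)) (u : T -> T) : (T -> T) -> Prop :=
| bruhat_refl : bruhat S u u
| bruhat_step v t k l : bruhat S u v -> reflection S t ->
    has_length S v k -> has_length S (v \o t) l -> (k < l)%N ->
    bruhat S u (v \o t).

Section AffineWeyl.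
Context (R : realType) (n : nat) (D : root_datum n).

Local Notation V := 'rV[R]_n.

Definition toV (x : 'rV[int]_n) : V := map_mx intr x.

Definition pairV (a : 'rV[int]_n) (x : V) : R := pairing (toV a) x.

Definition refl (a : 'rV[int]_n) (k : int) (x : V) : V :=
  x - (pairV a x - k%:~R) *: toV (coroot D a).

Definition W0 : set (V -> V) :=
  generated [set f | exists2 a, a \in roots D & f = refl a 0].

Definition Waff : set (V -> V) :=
  generated [set f | exists2 a, a \in roots D & exists k : int, f = refl a k].

Definition trans (v : V) (x : V) : V := x + v.

(* X_* >< W_0, identified with its image under its faithful action on V. *)
Definition Wext : set (V -> V) :=
  [set f | exists lam : 'rV[int]_n, exists2 w, W0 w & f = trans (toV lam) \o w].

Definition orbit0 (mu : 'rV[int]_n) : set V :=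
  [set v | exists2 w, W0 w & v = w (toV mu)].

Definition Conv (mu : 'rV[int]_n) : set V :=
  smallest (@convex_set R V) (orbit0 mu).

(* The facet of x for the arrangement of all hyperplanes H_{a,k}. *)
Definition facet (x : V) : set V :=
  [set y | forall a (k : int), a \in roots D ->
     Num.sg (pairV a y - k%:~R) = Num.sg (pairV a x - k%:~R)].

(* The affine span of F has dimension at least d. *)
Definition dim_ge (F : set V) (d : nat) : Prop :=
  exists (x : V) (u : 'M[R]_(d, n)),
    [/\ F x, forall i, F (x + row i u) & row_free u].

Context (Pi : seq 'rV[int]_n) (h : 'rV[int]_n). (* base, highest root *)

Definition Saff : set (V -> V) :=
  [set f | (exists2 a, a \in Pi & f = refl a 0) \/ f = refl h 1].

Definition A0 : set V :=
  [set x | (forall a, a \in Pi -> 0 < pairV a x) /\ pairV h x < 1].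

Definition Omega : set (V -> V) := [set f | Wext f /\ f @` A0 = A0].

(* Points of the facets of minimal dimension of the closure of A0. *)
Definition vertex (a : V) : Prop :=
  closure A0 a /\
  forall b d, closure A0 b -> dim_ge (facet a) d -> dim_ge (facet b) d.

Definition le_ext (x y : V -> V) : Prop :=
  exists w w' tau, [/\ Waff w, Waff w', Omega tau & bruhat Saff w w'] /\
    (x = w \o tau /\ y = w' \o tau).

Definition Adm (mu : 'rV[int]_n) : set (V -> V) :=
  [set x | Wext x /\ exists2 lam, orbit0 mu lam & le_ext x (trans lam)].

Definition Perm (mu : 'rV[int]_n) : set (V -> V) :=
  [set x | (exists tau, [/\ Omega tau,
                exists2 w, Waff w & trans (toV mu) = w \o tau &
                exists2 w, Waff w & x = w \o tau]) /\
           forall a, vertex a -> Conv mu (x a - a)].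

End AffineWeyl.

Arguments Adm R {n} D Pi h mu _.
Arguments Perm R {n} D Pi h mu _.

(* Main.v *)
From Pilot Require Import Defs.
From mathcomp Require Import all_boot all_order all_algebra.
From mathcomp Require Import all_classical all_reals all_analysis.
From mathcomp Require Import ring lra zify.

(** Let [W] be the finite Weyl group, and write [lam <= lam'] for vectors such that
    [lam' - lam] is a nonnegative combination of simple coroots.  Take [p] and [q] in [W] and put
    [x = p^-1 t_mu q], with [mu] dominant and far from the walls.

    - [x] is permissible as soon as [q y <= p y] for all [y] in the closed base
      alcove.  Indeed [x y - y] is the image under [p^-1] of [mu - (p y - q y)], and
      a point that lies below [mu] by a small combination of simple coroots is in
      the convex hull of the orbit of [mu] ([cert_Adm_neq_Perm]).

    - If [x] is admissible, then [p <= q] in the Bruhat order of [W]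
      ([Adm_rchain]).  Along a chain of the affine Bruhat order from [x] to some
      translation [t_lam], with [lam] in the orbit of [mu], the length of the
      translation part for an invariant form cannot decrease, and it has the same
      value at both ends; so each step is a reflection fixing [0] or [x 0], which
      amounts to one step upwards from [p] or one step downwards from [q] in [W]
      ([alcove_step]).  The chain ends where both elements coincide.

    So it suffices to find [p] and [q] with [q omega <= p omega] for every
    fundamental coweight [omega] but not [p <= q].  Such pairs were found by
    Deodhar outside type A in rank at least 4, and they exist already in the
    parabolic subgroup of a subdiagram of type B, C, D or F with four nodes, where
    they are verified by computation ([cert_B], ..., [cert_F2]).  That [p <= q]
    fails is seen on one orbit of weights: going down from [p omega] by reflections
    without leaving the set of weights above [q omega], one never meets [q omega]
    ([rchain_trapped]).

    A connected diagram with at least four nodes that is not of type A contains one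
    of these subdiagrams ([nonA_subdiagram]): a longest simply laced path does not
    contain all the nodes, and where another node is attached to it, positivity of
    the form ([branch_bound]) leaves no other possibility.

    Roots and coroots are compared throughout by the form
    [sum_g <g, x> <g, y>] over the roots [g], so that no choice of an invariant
    scalar product enters; lengths in words of simple affine reflections enter only
    through the exchange condition ([exchange]). *)

Set Implicit Arguments.
Unset Strict Implicit.
Unset Printing Implicit Defensive.

Import Order.TTheory GRing.Theory Num.Theory.
Import numFieldNormedType.Exports.
Import Pilot.Defs.

Local Open Scope ring_scope.

(** * The invariant form *)

Section Form.
Context (R : realType) (n : nat) (D : root_datum n) (hred : reduced D).
Implicit Types (x y z : 'rV[R]_n) (a b g : 'rV[int]_n).
Local Notation coV a := (toV R (coroot D a)).

Lemma pairVDr a x y : pairV a (x + y) = pairV a x + pairV a y.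
Proof.
by rewrite /pairV /pairing -big_split /=; apply: eq_bigr => i _; rewrite !mxE mulrDr.
Qed.

Lemma pairVZr a c x : pairV a (c *: x) = c * pairV a x.
Proof.
by rewrite /pairV /pairing big_distrr /=; apply: eq_bigr => i _; rewrite !mxE mulrCA.
Qed.

Lemma pairVNr a x : pairV a (- x) = - pairV a x.
Proof. by rewrite -scaleN1r pairVZr mulN1r. Qed.

Lemma pairVBr a x y : pairV a (x - y) = pairV a x - pairV a y.
Proof. by rewrite pairVDr pairVNr. Qed.

Lemma pairV0r a : pairV a (0 : 'rV[R]_n) = 0.
Proof. by rewrite -(scale0r 0) pairVZr mul0r. Qed.

Lemma pairVDl a b x : pairV (a + b) x = pairV a x + pairV b x.
Proof.
rewrite /pairV /pairing -big_split /=; apply: eq_bigr => i _.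
by rewrite !mxE rmorphD mulrDl.
Qed.

Lemma pairVZl a (k : int) x : pairV (k *: a) x = k%:~R * pairV a x.
Proof.
rewrite /pairV /pairing big_distrr /=; apply: eq_bigr => i _.
by rewrite !mxE rmorphM /= mulrA.
Qed.

Lemma pairVNl a x : pairV (- a) x = - pairV a x.
Proof. by rewrite -scaleN1r pairVZl mulN1r. Qed.

Lemma pairVBl a b x : pairV (a - b) x = pairV a x - pairV b x.
Proof. by rewrite pairVDl pairVNl. Qed.

Lemma pairV0l x : pairV 0 x = 0.
Proof. by rewrite -(scale0r 0) pairVZl mul0r. Qed.

Lemma pairV_suml (I : Type) (r : seq I) (F : I -> 'rV[int]_n) x :
  pairV (\sum_(i <- r) F i) x = \sum_(i <- r) pairV (F i) x.
Proof.
elim: r => [|i r IH]; first by rewrite !big_nil pairV0l.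
by rewrite !big_cons pairVDl IH.
Qed.

Lemma pairV_sumr (I : Type) (r : seq I) (F : I -> 'rV[R]_n) a :
  pairV a (\sum_(i <- r) F i) = \sum_(i <- r) pairV a (F i).
Proof.
elim: r => [|i r IH]; first by rewrite !big_nil pairV0r.
by rewrite !big_cons pairVDr IH.
Qed.

Lemma pairVMnl a k x : pairV (a *+ k) x = pairV a x *+ k.
Proof. by rewrite -scaler_nat pairVZl rmorph_nat mulr_natl. Qed.

Lemma pairV_toV a b : pairV a (toV R b) = (pairing a b)%:~R.
Proof.
rewrite /pairV /pairing rmorph_sum; apply: eq_bigr => i _.
by rewrite !mxE rmorphM.
Qed.

Lemma toVD a b : toV R (a + b) = toV R a + toV R b.
Proof. exact: map_mxD. Qed.

Lemma toVN a : toV R (- a) = - toV R a.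
Proof. exact: map_mxN. Qed.

Lemma toVZ (k : int) a : toV R (k *: a) = k%:~R *: toV R a.
Proof. exact: map_mxZ. Qed.

Lemma toV0 : toV R (0 : 'rV[int]_n) = 0.
Proof. exact: map_mx0. Qed.

Lemma pairVP a b : (forall x, pairV a x = pairV b x) -> a = b.
Proof.
have ev c i : pairV c (\row_j (j == i)%:R) = (c 0 i)%:~R :> R.
  rewrite /pairV /pairing (bigD1 i) //= !mxE eqxx mulr1 big1 ?addr0 // => j ji.
  by rewrite !mxE (negPf ji) mulr0.
by move=> h; apply/rowP => i; have := h (\row_j (j == i)%:R); rewrite !ev => /intr_inj.
Qed.

(** The reflection of the character lattice, adjoint to [refl D a 0]. *)
Definition srefl a b := b - pairing b (coroot D a) *: a.

Lemma pairV_srefl a b x : pairV (srefl a b) x = pairV b (refl D a 0 x).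
Proof.
rewrite /srefl /refl pairVBl pairVZl pairVBr pairVZr pairV_toV subr0.
by rewrite mulrC.
Qed.

Lemma srefl_root a b : a \in roots D -> b \in roots D -> srefl a b \in roots D.
Proof. exact: root_reflection. Qed.

Lemma pairV_corootK a : a \in roots D -> pairV a (coV a) = 2.
Proof. by move=> ha; rewrite pairV_toV pairing_coroot. Qed.

Lemma reflK a k : a \in roots D -> cancel (@refl R n D a k) (refl D a k).
Proof.
move=> ha x; rewrite /refl !pairVBr pairVZr (pairV_corootK ha).
set c := pairV a x; set m := k%:~R.
rewrite -addrA -opprD -scalerDl.
have -> : c - m + (c - (c - m) * 2 - m) = 0 by ring.
by rewrite scale0r subr0.
Qed.

Lemma refl0K a : a \in roots D -> cancel (@refl R n D a 0) (refl D a 0).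
Proof.
by move=> ha; apply: reflK.
Qed.

Lemma sreflK a : a \in roots D -> involutive (srefl a).
Proof. by move=> ha b; apply: pairVP => x; rewrite !pairV_srefl refl0K. Qed.

(** This form turns each coroot into a positive multiple of its root
    ([form_coroot]), which is how roots and coroots are compared below.
    Summing over [undup] makes the sum run over the set of roots, which the
    reflections permute. *)
Definition form x y : R := \sum_(g <- undup (roots D)) pairV g x * pairV g y.

Lemma formC x y : form x y = form y x.
Proof. by apply: eq_bigr => g _; rewrite mulrC. Qed.

Lemma formDr x y z : form x (y + z) = form x y + form x z.
Proof. by rewrite -big_split /=; apply: eq_bigr => g _; rewrite pairVDr mulrDr. Qed.

Lemma formZr c x y : form x (c *: y) = c * form x y.
Proof. by rewrite big_distrr /=; apply: eq_bigr => g _; rewrite pairVZr mulrCA. Qed.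

Lemma formDl x y z : form (y + z) x = form y x + form z x.
Proof. by rewrite formC formDr ![form x _]formC. Qed.

Lemma formZl c x y : form (c *: y) x = c * form y x.
Proof. by rewrite formC formZr formC. Qed.

Lemma formNr x y : form x (- y) = - form x y.
Proof. by rewrite -scaleN1r formZr mulN1r. Qed.

Lemma formNl x y : form (- x) y = - form x y.
Proof. by rewrite -scaleN1r formZl mulN1r. Qed.

Lemma form_suml (I : Type) (r : seq I) (F : I -> 'rV[R]_n) x :
  form (\sum_(i <- r) F i) x = \sum_(i <- r) form (F i) x.
Proof.
elim: r => [|i r IH].
  by rewrite !big_nil -(scale0r (0 : 'rV[R]_n)) formZl mul0r.
by rewrite !big_cons formDl IH.
Qed.

Lemma form_ge0 x : 0 <= form x x.
Proof. by apply: sumr_ge0 => g _; rewrite -expr2 sqr_ge0. Qed.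

Lemma form_eq0 x : form x x = 0 -> forall g, g \in roots D -> pairV g x = 0.
Proof.
move=> h g hg; have/allP/(_ g) : all (fun g => pairV g x * pairV g x == 0) (undup (roots D)).
  move/eqP: h; rewrite /form psumr_eq0 => [|? _]; last by rewrite -expr2 sqr_ge0.
  by move=> h; apply/allP => a /(allP h).
by rewrite mem_undup => /(_ hg); rewrite mulf_eq0 orbb => /eqP.
Qed.

Lemma form_refl0 a x y : a \in roots D ->
  form (refl D a 0 x) (refl D a 0 y) = form x y.
Proof.
move=> ha; rewrite /form.
under eq_bigr do rewrite -!pairV_srefl.
rewrite -(big_map (srefl a) xpredT (fun g => pairV g x * pairV g y)).
apply/perm_big/uniq_perm; rewrite ?undup_uniq ?map_inj_uniq ?undup_uniq //.
  exact: can_inj (sreflK ha).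
move=> b; rewrite mem_undup; apply/mapP/idP => [[c]|hb].
  by rewrite mem_undup => hc ->; apply: srefl_root.
by exists (srefl a b); rewrite ?sreflK // mem_undup srefl_root.
Qed.

Definition lsq a : R := form (coV a) (coV a).

Lemma refl0_coroot a : a \in roots D -> refl D a 0 (coV a) = - coV a.
Proof.
by move=> ha; rewrite /refl (pairV_corootK ha) subr0 scaler_nat mulr2n opprD addrA subrr sub0r.
Qed.

(** Invariance under [refl D a 0] makes pairing with [a] proportional to the form
    with the coroot of [a]. *)
Lemma form_coroot a y : a \in roots D ->
  2 * form (coV a) y = lsq a * pairV a y.
Proof.
move=> ha; have := form_refl0 (coV a) y ha.
rewrite refl0_coroot // formNl /refl subr0 formDr formNr formZr -/(lsq a) => h.
by rewrite mulrC in h; lra.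
Qed.

Lemma lsq_gt0 a : a \in roots D -> 0 < lsq a.
Proof.
move=> ha; rewrite lt_neqAle form_ge0 andbT eq_sym; apply/eqP => h.
have := form_eq0 h ha; rewrite pairV_corootK // => /eqP.
by rewrite pnatr_eq0.
Qed.

(** Both sides are twice the form of the two coroots. *)
Lemma lsq_sym a b : a \in roots D -> b \in roots D ->
  lsq a * (pairing a (coroot D b))%:~R = lsq b * (pairing b (coroot D a))%:~R.
Proof.
by move=> ha hb; rewrite -!pairV_toV -!form_coroot // formC.
Qed.

Let ilsq a : int := \sum_(g <- undup (roots D)) pairing g (coroot D a) ^+ 2.

Lemma lsqE a : lsq a = (ilsq a)%:~R.
Proof.
rewrite rmorph_sum; apply: eq_bigr => g _.
by rewrite pairV_toV -expr2 rmorphXn.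
Qed.

(** Some root [d] has the coroot [s_a(b^vee)].  The invariant form shows that [d] is
    a positive multiple of [s_a(b)], and the root system is reduced. *)
Lemma coroot_srefl a b : a \in roots D -> b \in roots D ->
  coroot D (srefl a b) = coroot D b - pairing a (coroot D b) *: coroot D a.
Proof.
move=> ha hb.
have /mapP[d hd dE] := coroot_reflection ha hb.
have dV : coV d = refl D a 0 (coV b).
  by rewrite -dE toVD toVN toVZ /refl pairV_toV subr0.
have key y : lsq d * pairV d y = lsq b * pairV (srefl a b) y.
  rewrite -form_coroot // dV pairV_srefl -form_coroot //.
  by rewrite -[in LHS](refl0K ha y) form_refl0.
have eqi : ilsq d *: d = ilsq b *: srefl a b.
  by apply: pairVP => y; rewrite !pairVZl -!lsqE.
have nz : ilsq d != 0 by rewrite -(intr_eq0 R) -lsqE gt_eqF ?lsq_gt0.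
rewrite dE; case: (hred hd (srefl_root ha hb) nz eqi) => [-> //|e].
exfalso; have := key (coV d); rewrite e pairVNl pairV_corootK //.
by move: (lsq_gt0 hd) (lsq_gt0 hb); clear; lra.
Qed.

Lemma srefl_self a : a \in roots D -> srefl a a = - a.
Proof.
move=> ha; rewrite /srefl (pairing_coroot ha).
by rewrite scaler_nat mulr2n opprD addrA subrr sub0r.
Qed.

Lemma rootN a : a \in roots D -> - a \in roots D.
Proof. by move=> ha; rewrite -srefl_self // srefl_root. Qed.

Lemma corootN a : a \in roots D -> coroot D (- a) = - coroot D a.
Proof.
move=> ha; rewrite -srefl_self // coroot_srefl // (pairing_coroot ha).
by rewrite scaler_nat mulr2n opprD addrA subrr sub0r.
Qed.

Lemma reflN a k x : a \in roots D -> refl D (- a) (- k) x = refl D a k x.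
Proof.
move=> ha; rewrite /refl corootN // toVN pairVNl scalerN -scaleNr.
by rewrite rmorphN /= opprK opprD !opprK.
Qed.


End Form.

(** * Affine automorphisms of the root datum *)

Section AffineAutomorphisms.
Context (R : realType) (n : nat) (D : root_datum n) (hred : reduced D).
Implicit Types (x y z : 'rV[R]_n) (a b : 'rV[int]_n).
Implicit Types (f g w s : 'rV[R]_n -> 'rV[R]_n).
Local Notation coV a := (toV R (coroot D a)).

Definition affine_root_map w : Prop :=
  (forall c x y, w (x + c *: y) = w x + c *: (w y - w 0)) /\
  (forall a, a \in roots D -> exists b, exists m : int,
    [/\ b \in roots D, forall x, pairV b (w x) = pairV a x + m%:~R &
        w (coV a) - w 0 = coV b]).

(** A common home for the elements of the finite, affine and extended affine Weyl
    groups.  Asking for an inverse of the same kind makes the class closed under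
    inverses, as the groups generated by reflections are. *)
Definition aff_aut w : Prop :=
  affine_root_map w /\
  exists w', [/\ cancel w w', cancel w' w & affine_root_map w'].

Lemma affine_subE w : (forall c x y, w (x + c *: y) = w x + c *: (w y - w 0)) ->
  forall y z, w (y - z) - w 0 = w y - w z.
Proof.
move=> h y z; rewrite -scaleN1r h scaleN1r opprB addrA.
by rewrite addrAC addrK.
Qed.

Lemma affine_root_map_comp f g : affine_root_map f -> affine_root_map g ->
  affine_root_map (f \o g).
Proof.
move=> [f1 f2] [g1 g2]; split=> [c x y|a ha] /=.
  by rewrite g1 f1 (affine_subE f1).
have [b [m [hb bE bV]]] := g2 _ ha.
have [d [k [hd dE dV]]] := f2 _ hb.
exists d, (m + k); split=> // [x|]; first by rewrite dE bE rmorphD addrA.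
by rewrite -(affine_subE f1) bV.
Qed.

Lemma affine_root_map_refl a k : a \in roots D -> affine_root_map (refl D a k).
Proof.
move=> ha; split=> [c x y|b hb].
  rewrite /refl !pairVDr pairVZr pairV0r; apply/rowP => i; rewrite !mxE.
  by ring.
exists (srefl D a b), (k * pairing (srefl D a b) (coroot D a)); split.
- exact: srefl_root.
- move=> x; rewrite rmorphM /= -pairV_toV !pairV_srefl !(pairVBr, pairVZr).
  by rewrite pairV_corootK // !subr0; ring.
- rewrite coroot_srefl // toVD toVN toVZ /refl -pairV_toV pairV0r.
  by apply/rowP => i; rewrite !mxE; ring.
Qed.

Lemma affine_root_map_trans v : affine_root_map (trans (toV R v)).
Proof.
split=> [c x y|a ha]; rewrite /trans; first by apply/rowP => i; rewrite !mxE; ring.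
exists a, (pairing a v); split=> // [x|]; first by rewrite pairVDr pairV_toV.
by rewrite add0r addrK.
Qed.

Lemma affine_root_map_id : affine_root_map id.
Proof.
split=> [c x y|a ha]; first by rewrite subr0.
by exists a, 0; split=> // [x|]; rewrite ?addr0 ?subr0.
Qed.

Lemma aff_aut_comp f g : aff_aut f -> aff_aut g -> aff_aut (f \o g).
Proof.
move=> [f1 [f' [fK f'K f2]]] [g1 [g' [gK g'K g2]]].
split; first exact: affine_root_map_comp.
exists (g' \o f'); split; [exact: can_comp | exact: can_comp |].
exact: affine_root_map_comp.
Qed.

Lemma aff_aut_refl a k : a \in roots D -> aff_aut (refl D a k).
Proof.
move=> ha; split; first exact: affine_root_map_refl.
exists (refl D a k); split; [exact: reflK | exact: reflK |].
exact: affine_root_map_refl.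
Qed.

Lemma aff_aut_trans v : aff_aut (trans (toV R v)).
Proof.
split; first exact: affine_root_map_trans.
exists (trans (toV R (- v))); split; last exact: affine_root_map_trans.
  by move=> x; rewrite /trans toVN addrK.
by move=> x; rewrite /trans toVN addrNK.
Qed.

Lemma aff_aut_id : aff_aut id.
Proof. by split; [|exists id; split]; try apply: affine_root_map_id. Qed.

Lemma aff_aut_inv f g : aff_aut f -> cancel f g -> cancel g f -> aff_aut g.
Proof.
move=> [f1 [f' [fK f'K f2]]] fg gf.
have -> : g = f' by apply/funext => x; rewrite -{1}(f'K x) fg.
by split=> //; exists f.
Qed.

Lemma generated_aff_aut (S : set ('rV[R]_n -> 'rV[R]_n)) f :
  (forall s, S s -> aff_aut s) -> generated S f -> aff_aut f.
Proof.
move=> hS; elim=> [||? ? _ ? _ ?|? ? _ ?]; first exact: aff_aut_id.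
- exact: hS.
- exact: aff_aut_comp.
- exact: aff_aut_inv.
Qed.

Lemma W0_aff_aut w : W0 D w -> aff_aut w.
Proof. by apply: generated_aff_aut => s [a ha ->]; apply: aff_aut_refl. Qed.

Lemma Waff_aff_aut w : Waff D w -> aff_aut w.
Proof. by apply: generated_aff_aut => s [a ha [k ->]]; apply: aff_aut_refl. Qed.

Lemma Wext_aff_aut w : Wext D w -> aff_aut w.
Proof.
move=> [lam [p hp ->]]; apply: aff_aut_comp; first exact: aff_aut_trans.
exact: W0_aff_aut.
Qed.

Lemma aff_aut_inverse w : aff_aut w -> exists w', [/\ cancel w w', cancel w' w & aff_aut w'].
Proof. by move=> [w1 [w' [wK w'K w2]]]; exists w'; do 2!split=> //; exists w. Qed.

Lemma aff_aut_conj w a : aff_aut w -> a \in roots D ->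
  exists b, exists m : int, [/\ b \in roots D,
    forall x, pairV b (w x) = pairV a x + m%:~R &
    forall k x, w (refl D a k x) = refl D b (k + m) (w x)].
Proof.
move=> [[w1 w2] _] ha; have [b [m [hb bE bV]]] := w2 a ha.
exists b, m; split=> // k x; rewrite /refl -scaleNr w1 bV bE scaleNr.
by congr (_ - _ *: _); rewrite rmorphD; ring.
Qed.

Lemma aff_aut_conj_inv w b : aff_aut w -> b \in roots D ->
  exists a, exists m : int, [/\ a \in roots D,
    forall x, pairV b (w x) = pairV a x + m%:~R &
    forall k x, w (refl D a k x) = refl D b (k + m) (w x)].
Proof.
move=> /aff_aut_inverse[w' [wK w'K /aff_aut_conj h]] /h[a [m [ha aE aR]]].
exists a, (- m); split=> // [x|k x].
  by have := aE (w x); rewrite wK rmorphN => ->; rewrite addrK.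
by apply: (can_inj w'K); rewrite wK aR wK subrK.
Qed.

Lemma W0_0 w : W0 D w -> w 0 = 0.
Proof.
elim=> [|f [a ha ->]|f g _ f0 _ g0|f g _ f0 fg gf] //=.
- by rewrite /refl pairV0r subr0 scale0r subr0.
- by rewrite g0.
- by rewrite -f0 fg f0.
Qed.

Lemma W0_linear w : W0 D w -> forall c x y, w (x + c *: y) = w x + c *: w y.
Proof. by move=> hw c x y; have [[-> _] _] := W0_aff_aut hw; rewrite W0_0 ?subr0. Qed.

Lemma W0_root w a : W0 D w -> a \in roots D ->
  exists2 b, b \in roots D & (forall x, pairV b (w x) = pairV a x) /\
    forall k x, w (refl D a k x) = refl D b k (w x).
Proof.
move=> hw /(aff_aut_conj (W0_aff_aut hw))[b [m [hb bE bR]]].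
have m0 : m = 0.
  by apply/(@intr_inj R); have := bE 0; rewrite W0_0 // !pairV0r add0r.
by exists b => //; split=> [x|k x]; rewrite ?bE ?bR m0 ?addr0.
Qed.

Lemma W0_inv w : W0 D w -> exists w', [/\ W0 D w', cancel w w' & cancel w' w].
Proof.
move=> hw; have [w' [wK w'K _]] := aff_aut_inverse (W0_aff_aut hw).
by exists w'; split=> //; apply: generated_inv wK w'K.
Qed.

Lemma form_W0 w x y : W0 D w -> form D (w x) (w y) = form D x y.
Proof.
move=> hw; elim: hw x y => [|f [a ha ->]|f g _ IHf _ IHg|f g _ IH fg gf] x y //=.
- exact: form_refl0.
- by rewrite IHf IHg.
- by rewrite -IH !gf.
Qed.

Lemma W0_Waff w : W0 D w -> Waff D w.
Proof.
elim=> [|f [a ha ->]|f g _ hf _ hg|f g _ hf fg gf].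
- exact: generated_id.
- by apply: generated_in; exists a => //; exists 0.
- exact: generated_comp.
- exact: generated_inv hf fg gf.
Qed.

End AffineAutomorphisms.

(** * Positive roots *)

Section Base.
Context (R : realType) (n : nat) (D : root_datum n) (hred : reduced D).
Context (Pi : seq 'rV[int]_n) (hPi : is_base D Pi).
Implicit Types (x y z : 'rV[R]_n) (a b g : 'rV[int]_n).
Local Notation coV a := (toV R (coroot D a)).

(** Linear independence over [int] survives over [R]: a rational relation
    becomes an integral one after clearing denominators, and the rank does not
    change from [rat] to [R]. *)
Lemma dual_vector (f : 'rV[int]_n -> R) :
  exists x : 'rV[R]_n, forall a, a \in Pi -> pairV a x = f a.
Proof.
have [uPi _ indep _] := hPi.
pose m := size Pi; pose A : 'M[int]_(m, n) := \matrix_(i < m) nth 0 Pi i.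
pose AQ : 'M[rat]_(m, n) := map_mx intr A.
have freeQ : row_free AQ.
  apply/row_freeP; suff: kermx AQ = 0.
    by move/eqP; rewrite kermx_eq0 => /row_freeP.
  apply/eqP/rowV0P => u /sub_kermxP uA.
  pose d : int := \prod_i denq (u 0 i).
  pose e (i : 'I_m) : int := numq (u 0 i) * \prod_(j < m | j != i) denq (u 0 j).
  have eE i : (e i)%:~R = u 0 i * d%:~R :> rat.
    rewrite /e /d [in RHS](bigD1 i) //= !rmorphM /= mulrA; congr (_ * _).
    exact: numqE.
  pose c a : int := if insub (index a Pi) is Some i then e i else 0.
  have cE (i : 'I_m) : c (nth 0 Pi i) = e i.
    by rewrite /c index_uniq // insubT // => hi; congr e; apply: val_inj.
  have rel0 : \sum_(a <- Pi) c a *: a = 0.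
    rewrite (big_nth 0) big_mkord; apply/rowP => j; rewrite summxE.
    apply: (@intr_inj rat); rewrite rmorph_sum !mxE.
    transitivity (d%:~R * (u *m AQ) 0 j).
      rewrite mxE big_distrr /=; apply: eq_bigr => i _.
      by rewrite cE !mxE rmorphM /= eE; ring.
    by rewrite uA mxE mulr0.
  apply/rowP => i; rewrite mxE; apply/eqP.
  have /eqP := indep _ rel0 (nth 0 Pi i) (mem_nth _ (ltn_ord i)).
  rewrite cE -(intr_eq0 rat) eE mulf_eq0 intr_eq0 => /orP[//|].
  by rewrite prodf_seq_eq0 => /hasP[j _]; rewrite denq_eq0.
have freeR : row_free (map_mx ratr AQ : 'M[R]_(m, n)) by rewrite row_free_map.
have /row_freeP[B AB] := freeR.
pose F : 'cV[R]_m := \col_i f (nth 0 Pi i).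
exists (B *m F)^T => a aPi.
have hi : (index a Pi < m)%N by rewrite index_mem.
have := congr1 (fun M => (M *m F) (Ordinal hi) 0) AB.
rewrite mul1mx [in RHS]mxE /= nth_index // => <-.
rewrite -mulmxA [RHS]mxE /pairV /pairing; apply: eq_bigr => j _.
by rewrite !mxE /= nth_index // ratr_int.
Qed.

Lemma root_neq0 a : a \in roots D -> a != 0.
Proof.
move=> ha; apply/eqP => a0; have := pairV_corootK R ha.
by rewrite a0 pairV0l => /eqP; rewrite eq_sym pnatr_eq0.
Qed.

Lemma nonneg_combE v x (c : 'rV[int]_n -> nat) : v = \sum_(a <- Pi) a *+ c a ->
  pairV v x = \sum_(a <- Pi) pairV a x *+ c a.
Proof. by move=> ->; rewrite pairV_suml; apply: eq_bigr => a _; rewrite pairVMnl. Qed.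

Definition dominant x := forall a, a \in Pi -> 0 <= pairV a x.

Lemma nonneg_comb_ge0 v x : nonneg_comb Pi v -> dominant x -> 0 <= pairV v x.
Proof.
move=> [c /nonneg_combE ->] hx; rewrite big_seq; apply: sumr_ge0 => a /hx.
exact: mulrn_wge0.
Qed.

Lemma nonneg_comb_gt0 v x : nonneg_comb Pi v -> v != 0 ->
  (forall a, a \in Pi -> 0 < pairV a x) -> 0 < pairV v x.
Proof.
move=> [c vE] v0 hx; rewrite (nonneg_combE x vE) big_seq.
have ge0 a : a \in Pi -> 0 <= pairV a x *+ c a by move=> /hx/ltW; apply: mulrn_wge0.
rewrite lt_neqAle eq_sym sumr_ge0 // andbT; apply: contraNneq v0 => /eqP.
rewrite psumr_eq0 // => /allP h; rewrite vE big_seq big1 // => a ha.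
by have := h _ ha; rewrite ha /= mulrn_eq0 orbC gt_eqF ?hx //= => /eqP ->.
Qed.

Lemma root_pos_or_neg b : b \in roots D -> nonneg_comb Pi b \/ nonneg_comb Pi (- b).
Proof. by have [_ _ _] := hPi; apply. Qed.

Lemma pos_root_of_dominant b x : b \in roots D -> dominant x -> 0 < pairV b x ->
  nonneg_comb Pi b.
Proof.
move=> hb hx hbx; case: (root_pos_or_neg hb) => // hn.
by have := nonneg_comb_ge0 hn hx; rewrite pairVNl oppr_ge0 leNgt hbx.
Qed.

Lemma exists_rho : exists rho : 'rV[R]_n, forall a, a \in Pi -> pairV a rho = 1.
Proof. exact: dual_vector. Qed.

Lemma Pi_root a : a \in Pi -> a \in roots D.
Proof. by have [_ h _ _] := hPi; apply: h. Qed.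

Lemma pos_neg_absurd b : b \in roots D -> nonneg_comb Pi b -> nonneg_comb Pi (- b) -> False.
Proof.
move=> hb h1 h2; have [rho hrho] := exists_rho.
have rpos a : a \in Pi -> 0 < pairV a rho by move=> /hrho ->.
have := nonneg_comb_gt0 h1 (root_neq0 hb) rpos.
have := nonneg_comb_gt0 h2 (root_neq0 (rootN hb)) rpos.
by rewrite pairVNl; lra.
Qed.

Lemma simple_pos a : a \in Pi -> nonneg_comb Pi a.
Proof.
move=> ha; have [uPi _ _ _] := hPi; exists (fun b => (b == a)%N).
rewrite (bigD1_seq a) //= eqxx big1 ?addr0 // => b /negPf ->.
by rewrite mulr0n.
Qed.

(** A positive root other than [a] involves another simple root, whose
    coefficient the reflection in [a] does not change. *)
Lemma simple_srefl_pos a b : a \in Pi -> b \in roots D -> nonneg_comb Pi b ->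
  b != a -> nonneg_comb Pi (srefl D a b).
Proof.
move=> ha hb [c bE] ba; have [uPi _ _ _] := hPi.
have ha' := Pi_root ha.
have [/hasP[d hd /andP[da cd]]|/hasPn none] := boolP (has (fun d => (d != a) && (c d != 0%N)) Pi).
  have [x hx] := dual_vector (fun g => (g == d)%:R).
  apply: (@pos_root_of_dominant _ x); first exact: srefl_root.
    by move=> g /hx ->; rewrite ler0n.
  rewrite pairV_srefl /refl pairVBr pairVZr (hx a ha) eq_sym (negPf da) subr0 mul0r subr0.
  rewrite (nonneg_combE x bE) (bigD1_seq d) //= hx // eqxx big_seq_cond big1 => [|g].
    by rewrite addr0 ltr0n lt0n.
  by move=> /andP[/hx -> /negPf ->]; rewrite mul0rn.
exfalso; have bca : b = (c a)%:Z *: a.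
  rewrite {1}bE (bigD1_seq a) //= big_seq_cond big1 ?addr0 => [|g /andP[/none h ga]].
    by rewrite -scaler_nat natz.
  by move: h; rewrite ga /= negbK => /eqP ->.
have ca0 : (c a)%:Z != 0.
  by apply: contraNneq (root_neq0 hb) => c0; rewrite bca c0 scale0r.
have : (c a)%:Z *: a = 1 *: b by rewrite scale1r.
case/(hred ha' hb ca0) => [/eqP|bN]; first by rewrite (negPf ba).
apply: (pos_neg_absurd hb); first by exists c.
by rewrite bN opprK; apply: simple_pos.
Qed.

End Base.

(** * The base alcove and the exchange condition *)

Section Alcove.
Context (R : realType) (n : nat) (D : root_datum n) (hred : reduced D).
Context (Pi : seq 'rV[int]_n) (hPi : is_base D Pi).
Context (h : 'rV[int]_n) (hh : is_highest_root D Pi h).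
Implicit Types (x y z p : 'rV[R]_n) (a b : 'rV[int]_n).
Implicit Types (f g s t u v w : 'rV[R]_n -> 'rV[R]_n).
Local Notation coV a := (toV R (coroot D a)).
Local Notation A0 := (@A0 R n Pi h).
Local Notation S := (@Saff R n D Pi h).

Lemma highest_root : h \in roots D. Proof. by case: hh. Qed.

Lemma highest_ge b x : b \in roots D -> dominant Pi x -> pairV b x <= pairV h x.
Proof.
move=> hb hx; rewrite -subr_ge0 -pairVBl.
by apply: nonneg_comb_ge0 hx; case: hh => _; apply.
Qed.

Lemma dominant_gt0 x : (forall a, a \in Pi -> 0 < pairV a x) -> dominant Pi x.
Proof. by move=> hx a /hx/ltW. Qed.

Lemma highest_pos : nonneg_comb Pi h.
Proof.
have [rho hrho] := exists_rho R hPi.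
have rho_dom : dominant Pi rho by move=> a /hrho ->.
apply: (pos_root_of_dominant hPi highest_root rho_dom).
have rho_gt0 a : a \in Pi -> 0 < pairV a rho by move=> /hrho ->.
case: (root_pos_or_neg hPi highest_root) => [hp|hn].
  by apply: nonneg_comb_gt0 rho_gt0 => //; apply: (root_neq0 R) highest_root.
have := nonneg_comb_gt0 hn (root_neq0 R (rootN highest_root)) rho_gt0.
have := highest_ge (rootN highest_root) rho_dom.
by rewrite !pairVNl; lra.
Qed.

Lemma A0_nonempty : exists p, A0 p.
Proof.
have [rho hrho] := exists_rho R hPi.
have rho_dom : dominant Pi rho by move=> a /hrho ->.
have hge0 : 0 <= pairV h rho by apply: nonneg_comb_ge0 highest_pos _.
exists ((pairV h rho + 1)^-1 *: rho); split=> [a /hrho ha|]; rewrite pairVZr.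
  by rewrite ha mulr1 invr_gt0 ltr_wpDl.
by rewrite mulrC ltr_pdivrMr ?mul1r; lra.
Qed.

Lemma A0_dominant p : A0 p -> dominant Pi p.
Proof. by move=> [hp _]; apply: dominant_gt0. Qed.

Lemma A0_pos p b : A0 p -> b \in roots D -> nonneg_comb Pi b -> 0 < pairV b p < 1.
Proof.
move=> hp hb bpos; have [pgt0 plt1] := hp.
rewrite (nonneg_comb_gt0 bpos (root_neq0 R hb) pgt0) /=.
exact: le_lt_trans (highest_ge hb (A0_dominant hp)) plt1.
Qed.

Lemma A0_root p b : A0 p -> b \in roots D ->
  nonneg_comb Pi b /\ 0 < pairV b p < 1 \/
  nonneg_comb Pi (- b) /\ -1 < pairV b p < 0.
Proof.
move=> hp hb; case: (root_pos_or_neg hPi hb) => hc; [left|right]; split=> //.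
  exact: A0_pos.
by have := A0_pos hp (rootN hb) hc; rewrite pairVNl; lra.
Qed.

Lemma same_side (m l : int) (c d : R) : m%:~R < c < m%:~R + 1 ->
  m%:~R < d < m%:~R + 1 -> 0 < (c - l%:~R) * (d - l%:~R).
Proof.
move=> /andP[c1 c2] /andP[d1 d2]; case: (lerP l m) => lm.
  have : l%:~R <= m%:~R :> R by rewrite ler_int.
  by move=> ?; apply: mulr_gt0; lra.
have : m%:~R + 1 <= l%:~R :> R by rewrite -[1]/(1%:~R) -intrD ler_int; lia.
by move=> ?; rewrite -mulrNN; apply: mulr_gt0; lra.
Qed.

(** Write [m] for the pairing.  Both [s_h(a) = a - m h] and its opposite are at most
    [h], which confines [m] to 0 and 1 because [0 < a < h] in height. *)
Lemma highest_coroot a : a \in roots D -> nonneg_comb Pi a -> a != h ->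
  pairing a (coroot D h) = 0 \/
  pairing a (coroot D h) = 1 /\ nonneg_comb Pi (- srefl D h a).
Proof.
move=> ha apos ah; set m := pairing _ _.
have [rho hrho] := exists_rho R hPi.
have rho_gt0 b : b \in Pi -> 0 < pairV b rho by move=> /hrho ->.
have rho_dom := dominant_gt0 rho_gt0.
have hroot := highest_root.
have h_gt0 := nonneg_comb_gt0 highest_pos (root_neq0 R hroot) rho_gt0.
have a_gt0 := nonneg_comb_gt0 apos (root_neq0 R ha) rho_gt0.
have ah_lt : pairV a rho < pairV h rho.
  rewrite -subr_gt0 -pairVBl; apply: nonneg_comb_gt0 rho_gt0.
    by case: hh => _; apply.
  by rewrite subr_eq0 eq_sym.
have sE : pairV (srefl D h a) rho = pairV a rho - m%:~R * pairV h rho.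
  by rewrite /srefl pairVBl pairVZl.
have sroot := srefl_root hroot ha.
have := highest_ge sroot rho_dom.
have := highest_ge (rootN sroot) rho_dom.
rewrite pairVNl sE => le1 le2.
have mlt2 : m < 2.
  rewrite ltNge; apply/negP => m2; have : 2%:~R <= m%:~R :> R by rewrite ler_int.
  by move=> m2'; nra.
have mgt : -1 < m.
  rewrite ltNge; apply/negP => m1; have : m%:~R <= (-1)%:~R :> R by rewrite ler_int.
  by rewrite rmorphN /= => m1'; nra.
have [->|m1] : m = 0 \/ m = 1 by lia.
  by left.
right; split=> //; apply: (pos_root_of_dominant hPi _ rho_dom); first exact: rootN.
by rewrite pairVNl sE m1 mul1r; lra.
Qed.

Lemma Saff_side_pos p s a (l : int) : A0 p -> S s -> a \in roots D ->
  nonneg_comb Pi a ->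
  s = refl D a l \/ 0 < (pairV a p - l%:~R) * (pairV a (s p) - l%:~R).
Proof.
move=> hp [[b hb ->]|->] ha apos.
  have hbr := Pi_root hPi hb.
  have [->|ab] := eqVneq a b.
    have [->|l0] := eqVneq l 0; first by left.
    right; have /andP[p0 p1] := A0_pos hp hbr (simple_pos hPi hb).
    rewrite -(pairV_srefl) srefl_self // pairVNl.
    case: (lerP l 0) => lm.
      have : l%:~R <= (-1)%:~R :> R by rewrite ler_int; lia.
      by rewrite rmorphN /= => ?; apply: mulr_gt0; lra.
    have : 1%:~R <= l%:~R :> R by rewrite ler_int; lia.
    by move=> ?; rewrite -mulrNN; apply: mulr_gt0; lra.
  right; apply: (@same_side 0); rewrite add0r; first exact: A0_pos.
  rewrite -pairV_srefl; apply: A0_pos => //; first exact: srefl_root.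
  exact: (simple_srefl_pos R).
have hroot := highest_root.
have spE : pairV a (refl D h 1 p) =
    pairV (srefl D h a) p + (pairing a (coroot D h))%:~R.
  by rewrite pairV_srefl /refl !pairVBr !pairVZr !pairV_toV; ring.
have /andP[p0 p1] := A0_pos hp ha apos.
have [ah|ah] := eqVneq a h.
  have [->|l1] := eqVneq l 1; first by left; rewrite ah.
  right; rewrite spE ah srefl_self // pairVNl pairing_coroot //.
  move: p0 p1; rewrite ah => p0 p1.
  case: (lerP l 1) => lm.
    have : l%:~R <= 0%:~R :> R by rewrite ler_int; lia.
    by rewrite rmorph0 => ?; apply: mulr_gt0; lra.
  have : 2%:~R <= l%:~R :> R by rewrite ler_int; lia.
  by move=> ?; rewrite -mulrNN; apply: mulr_gt0; lra.
right; apply: (@same_side 0); rewrite add0r; first exact: A0_pos.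
rewrite spE; case: (highest_coroot ha apos ah) => [m0|[m1 sneg]].
  by rewrite pairV_srefl /refl pairVBr pairVZr pairV_toV m0 mulr0 subr0 addr0 p0.
have := A0_pos hp (rootN (srefl_root hroot ha)) sneg.
by rewrite m1 pairVNl; lra.
Qed.

(** The base alcove and its image under a simple affine reflection are separated by
    one hyperplane only, the wall of that reflection: a simple reflection
    permutes the other positive roots, and the highest root is long. *)
Lemma Saff_side p s a (l : int) : A0 p -> S s -> a \in roots D ->
  s = refl D a l \/ 0 < (pairV a p - l%:~R) * (pairV a (s p) - l%:~R).
Proof.
move=> hp hs ha; case: (root_pos_or_neg hPi ha) => hc.
  exact: Saff_side_pos.
case: (Saff_side_pos (- l) hp hs (rootN ha) hc) => [->|].
  by left; apply/funext => x; rewrite reflN.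
by rewrite !pairVNl rmorphN -mulrNN !opprD !opprK; right.
Qed.

Lemma Saff_refl s : S s -> exists2 a, a \in roots D & exists k, s = refl D a k.
Proof.
move=> [[a ha ->]|->]; last by exists h; [exact: highest_root | exists 1].
by have hr := Pi_root hPi ha; exists a => //; exists 0.
Qed.

Lemma Saff_aff_aut s : S s -> aff_aut D s.
Proof. by move=> /Saff_refl[a ha [k ->]]; apply: aff_aut_refl. Qed.

Lemma word_aff_aut k w : has_word S k w -> aff_aut D w.
Proof.
elim=> [|{}k s {}w hs _ IH]; first exact: aff_aut_id.
by apply: aff_aut_comp IH; apply: Saff_aff_aut.
Qed.

(** The exchange condition: a gallery from [A0] to [w A0] crosses each separating
    hyperplane, and folding it there shortens the word. *)
Lemma exchange k w p a (l : int) : has_word S k w -> A0 p -> a \in roots D ->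
  (pairV a p - l%:~R) * (pairV a (w p) - l%:~R) < 0 ->
  exists2 j, (j < k)%N & has_word S j (refl D a l \o w).
Proof.
move=> hw hp; elim: hw a l => [|{}k s {}w hs hw IH] a l ha.
  by rewrite /= ltNge -expr2 sqr_ge0.
case: (Saff_side l hp hs ha) => [sE _|side sep].
  exists k => //; rewrite (_ : _ \o _ = w) //.
  have [b hb [m sE']] := Saff_refl hs.
  by apply/funext => x; rewrite /= -sE sE' reflK.
have [b [m [hb bE bR]]] := aff_aut_conj (Saff_aff_aut hs) ha.
have [c hc [m' sE]] := Saff_refl hs.
have sK x : s (s x) = x by rewrite sE reflK.
have bsE x : pairV b x - (l + m)%:~R = pairV a (s x) - l%:~R.
  by rewrite -{1}(sK x) bE rmorphD /=; ring.
have [|j jk hj] := IH b (l + m) hb.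
  rewrite !bsE; move: side sep => /=.
  set A := pairV a p - _; set B := pairV a (s p) - _; set C := pairV a _ - _.
  move=> AB AC; rewrite ltNge; apply/negP => BC.
  have ABC : (A * B) * (A * C) < 0 by rewrite pmulr_rlt0.
  have := mulr_ge0 (sqr_ge0 A) BC.
  by rewrite (_ : A ^+ 2 * _ = (A * B) * (A * C)); [lra | ring].
exists j.+1; first by rewrite ltnS.
rewrite (_ : _ \o _ = s \o (refl D b (l + m) \o w)); first exact: word_cons.
by apply/funext => x; apply: (can_inj sK); rewrite /= sK bR sK.
Qed.

End Alcove.

(** * Admissible elements *)

Section BruhatChain.
Context (R : realType) (n : nat) (D : root_datum n) (hred : reduced D).
Context (Pi : seq 'rV[int]_n) (hPi : is_base D Pi).
Context (h : 'rV[int]_n) (hh : is_highest_root D Pi h).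
Implicit Types (x y z : 'rV[R]_n) (a b : 'rV[int]_n).
Implicit Types (f g s t u v w p q tau : 'rV[R]_n -> 'rV[R]_n).
Local Notation coV a := (toV R (coroot D a)).
Local Notation A0 := (@A0 R n Pi h).
Local Notation S := (@Saff R n D Pi h).

Lemma generated_Saff_aff_aut f : generated S f -> aff_aut D f.
Proof. by apply: generated_aff_aut; apply: (Saff_aff_aut hred hPi hh). Qed.

Lemma reflection_conj v t : aff_aut D v -> reflection S t ->
  exists2 a, a \in roots D & exists m : int, v \o t = refl D a m \o v.
Proof.
move=> hv [f [g [s [hf fg gf hs ->]]]].
have [b hb [m ->]] := Saff_refl hPi hh hs.
have [a [k [ha _ aR]]] := aff_aut_conj (aff_aut_comp hv (generated_Saff_aff_aut hf)) hb.
exists a => //; exists (m + k); apply/funext => x /=.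
by have := aR m (g x); rewrite /= gf.
Qed.

(** Roots take no integral value on [A0], so neither do they on its images. *)
Lemma wall_generic x a (m : int) w : A0 x -> aff_aut D w -> a \in roots D ->
  pairV a (w x) != m%:~R.
Proof.
move=> hx hw ha; have [b [k [hb bE _]]] := aff_aut_conj_inv hw ha.
rewrite bE eq_sym -subr_eq -rmorphB /=; apply/eqP => e.
case: (A0_root hPi hh hx hb) => [[_]|[_]]; rewrite -e.
  by rewrite -[0]/(0%:~R) -[1]/(1%:~R) !ltr_int; lia.
by rewrite -[0]/(0%:~R) -[-1]/((-1)%:~R) !ltr_int; lia.
Qed.

(** If the hyperplane of the step separated [A0] from the alcove at hand, the
    exchange condition would shorten the word.  The sign of the root is chosen
    so that both alcoves lie on the negative side. *)
Lemma bruhat_step_side v t k l x : reflection S t ->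
  has_length S v k -> has_length S (v \o t) l -> (k < l)%N -> A0 x ->
  exists a, exists m : int, [/\ a \in roots D, v \o t = refl D a m \o v,
    pairV a x < m%:~R & pairV a (v x) < m%:~R].
Proof.
move=> ht [hv _] [_ hmin] kl hx; have av := word_aff_aut hred hPi hh hv.
have [a ha [m vt]] := reflection_conj av ht.
have nz1 := wall_generic m hx (aff_aut_id R D) ha.
have nz2 := wall_generic m hx av ha.
have nosep : 0 <= (pairV a x - m%:~R) * (pairV a (v x) - m%:~R).
  rewrite leNgt; apply/negP => sep.
  have [j jk hj] := exchange hred hPi hh hv hx ha sep.
  by have := hmin j; rewrite vt => /(_ hj); lia.
move: nz1 nz2; rewrite -[pairV a (v x) == _]subr_eq0.
case: (ltrgtP (pairV a x) m%:~R) => [lt1|lt1|//].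
  move=> _ nz2; exists a, m; split=> //.
  rewrite -subr_lt0 lt_neqAle nz2 /=.
  by move: nosep; rewrite nmulr_rge0 ?subr_lt0.
move=> _ nz2; exists (- a), (- m); split; first exact: rootN.
- by rewrite vt; apply/funext => y /=; rewrite reflN.
- by rewrite pairVNl rmorphN ltrN2.
- rewrite pairVNl rmorphN ltrN2 -subr_gt0 lt_neqAle eq_sym nz2 /=.
  by move: nosep; rewrite pmulr_rge0 ?subr_gt0.
Qed.

(** On the finite Weyl group this is the Bruhat order: the condition on [b] says that
    [p^-1 b] is a positive root, so that passing from [p] to [s_b p] increases the
    length.  In this form each step visibly lowers [p x], for [x] dominant, by a
    nonnegative multiple of a positive coroot. *)
Inductive rchain : ('rV[R]_n -> 'rV[R]_n) -> ('rV[R]_n -> 'rV[R]_n) -> Prop :=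
| rchain_refl p : rchain p p
| rchain_step p q b : b \in roots D -> nonneg_comb Pi b ->
    (forall x, dominant Pi x -> 0 <= pairV b (p x)) ->
    rchain (refl D b 0 \o p) q -> rchain p q.

Lemma rchain_trans p q r : rchain p q -> rchain q r -> rchain p r.
Proof.
elim=> // {}p {}q b hb bpos hp _ IH /IH; exact: rchain_step.
Qed.

Lemma rchain_one p b : b \in roots D -> nonneg_comb Pi b ->
  (forall x, dominant Pi x -> 0 <= pairV b (p x)) -> rchain p (refl D b 0 \o p).
Proof. by move=> hb bpos hp; apply: (rchain_step hb bpos hp); apply: rchain_refl. Qed.

Lemma rchain_form p q x y : rchain p q -> dominant Pi x -> dominant Pi y ->
  form D y (q x) <= form D y (p x).
Proof.
move=> + hx hy; elim=> // {}p {}q b hb bpos hp _ IH; apply: le_trans IH _.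
rewrite /= {1}/refl subr0 formDr formNr formZr gerDl oppr_le0.
rewrite formC; have := form_coroot y hb.
have := nonneg_comb_ge0 bpos hy; have := lsq_gt0 R hb; have := hp x hx.
set c := pairV b (p x); set d := pairV b y; set e := form _ _ _ => c0 l0 d0 e2.
apply: mulr_ge0 => //; have := mulr_ge0 (ltW l0) d0; lra.
Qed.

Section Regular.
Context (mu : 'rV[int]_n) (mu_reg : forall a, a \in Pi -> 1 <= pairing a mu).

Lemma regular_pairV a : a \in Pi -> 0 < pairV a (toV R mu).
Proof. by move=> /mu_reg hmu; rewrite pairV_toV ltr0z; lia. Qed.

Lemma regular_root b : b \in roots D ->
  nonneg_comb Pi b /\ 0 < pairV b (toV R mu) \/
  nonneg_comb Pi (- b) /\ pairV b (toV R mu) < 0.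
Proof.
move=> hb; case: (root_pos_or_neg hPi hb) => hc; [left|right]; split=> //.
  exact: nonneg_comb_gt0 hc (root_neq0 R hb) regular_pairV.
have := nonneg_comb_gt0 hc (root_neq0 R (rootN hb)) regular_pairV.
by rewrite pairVNl oppr_gt0.
Qed.

(** With [c = m - <a, x 0>] and [d = m], the reflection changes the squared length
    of the translation part [x 0] by [c * d * lsq a], and both factors are
    nonnegative because [A0] and its image under [x] lie on one side.  If the
    length does not change, then the hyperplane passes through [0] or through
    [x 0]: the reflection is absorbed by [p] in the first case and by [q] in the
    second, and the side on which the alcoves lie gives the direction of the step
    in the Bruhat order of the finite Weyl group. *)
Lemma alcove_step (x : 'rV[R]_n -> 'rV[R]_n) y0 z0 a (m : int) : aff_aut D x -> A0 y0 -> A0 z0 ->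
  a \in roots D -> pairV a z0 < m%:~R -> pairV a (x y0) < m%:~R ->
  form D (x 0) (x 0) <= form D (refl D a m (x 0)) (refl D a m (x 0)) /\
  (form D (refl D a m (x 0)) (refl D a m (x 0)) <= form D (x 0) (x 0) ->
   forall p q, W0 D p -> W0 D q -> (forall y, p (x y) = q y + toV R mu) ->
   exists p' q', [/\ W0 D p', W0 D q',
     forall y, p' (refl D a m (x y)) = q' y + toV R mu, rchain p p' & rchain q' q]).
Proof.
move=> hx hy0 hz0 ha z0m xm.
have m_ge0 : 0 <= m.
  suff: (-1)%:~R < m%:~R :> R by rewrite ltr_int; lia.
  apply: le_lt_trans z0m; rewrite rmorphN /=.
  by case: (A0_root hPi hh hz0 ha) => [[_]|[_]]; lra.
have [b [k [hb bE _]]] := aff_aut_conj_inv hx ha.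
have km : k <= m.
  suff: k%:~R < (m + 1)%:~R :> R by rewrite ltr_int; lia.
  rewrite rmorphD /=; move: xm; rewrite bE.
  by case: (A0_root hPi hh hy0 hb) => [[_]|[_]]; lra.
have x0E : pairV a (x 0) = k%:~R by rewrite bE pairV0r add0r.
have normE : form D (refl D a m (x 0)) (refl D a m (x 0)) =
    form D (x 0) (x 0) + (m - k)%:~R * m%:~R * lsq R D a.
  rewrite /refl x0E formDl !formDr !formNl !formNr !formZl !formZr -/(lsq R D a).
  rewrite (formC D (x 0)); have := form_coroot (x 0) ha; rewrite x0E rmorphB /=.
  set e := form D _ (x 0); set N := form D _ _; set L := lsq R D a => e2.
  have -> : e = L * k%:~R / 2 by rewrite -e2; field.
  by field.
have la := lsq_gt0 R ha.
split.
  rewrite normE lerDl; apply: mulr_ge0 (ltW la).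
  by rewrite -rmorphM /= ler0z; apply: mulr_ge0; lia.
rewrite normE gerDl pmulr_lle0 // -rmorphM /= lerz0 => mk p q hp hq pE.
have [g hg [gE gR]] := W0_root hred hp ha.
have gmu : pairV g (toV R mu) = k%:~R.
  by rewrite -x0E -gE pE (W0_0 hq) add0r.
have [m0|k0] : m = 0 \/ k = m by nia.
  (* The reflection fixes the origin: [p] becomes [p s_a = s_g p], with [- g]
     positive since [mu] is regular. *)
  have gneg : nonneg_comb Pi (- g).
    case: (regular_root hg) => [[_]|[//]]; rewrite gmu ltr0z; lia.
  have hg' := rootN hg.
  exists (p \o refl D a 0), q; split=> //.
  - by apply: generated_comp => //; apply: generated_in; exists a.
  - by move=> y; rewrite /= m0 reflK // pE.
  - have -> : p \o refl D a 0 = refl D (- g) 0 \o p.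
      by apply/funext => y /=; rewrite gR -[0 in RHS]oppr0 reflN.
    apply: rchain_one => // y hy.
    have aneg : nonneg_comb Pi (- a).
      move: z0m; rewrite m0; case: (A0_root hPi hh hz0 ha) => [[_]|[]//].
      by move=> /andP[? _]; lra.
    by rewrite pairVNl gE -pairVNl; apply: nonneg_comb_ge0 aneg hy.
  - exact: rchain_refl.
(* The reflection fixes [x 0], which [p] sends to [mu]; conjugating it by [p] and then
   by the translation gives the linear reflection in [g] that acts on [q]. *)
have gpos : nonneg_comb Pi g.
  case: (regular_root hg) => [[//]|[_]]; rewrite gmu ltrz0; lia.
have refl_mu y : refl D g m (y + toV R mu) = refl D g 0 y + toV R mu.
  rewrite /refl pairVDr gmu k0 addrK subr0.
  by rewrite addrAC.
have [qi [hqi qqi qiq]] := W0_inv hred hq.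
have [e he [eE _]] := W0_root hred hqi hg.
exists p, (refl D g 0 \o q); split=> //.
- by apply: generated_comp => //; apply: generated_in; exists g.
- by move=> y; rewrite gR pE refl_mu.
- exact: rchain_refl.
- have {2}-> : q = refl D g 0 \o (refl D g 0 \o q).
    by apply/funext => y /=; rewrite reflK.
  apply: rchain_one => // y hy /=.
  rewrite -pairV_srefl srefl_self // pairVNl -(eE (q y)) qqi.
  rewrite -pairVNl; apply: nonneg_comb_ge0 _ hy.
  case: (root_pos_or_neg hPi he) => // epos.
  have := A0_pos hh hy0 he epos.
  by move: xm; rewrite -gE pE pairVDr gmu k0 gtrDr -(eE (q y0)) qqi; lra.
Qed.

Lemma Omega_A0 tau x : Omega D Pi h tau -> A0 x -> exists2 y, A0 y & tau y = x.
Proof. by move=> [_ tauA] hx; move: (hx); rewrite -{1}tauA => -[y hy <-]; exists y. Qed.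

Lemma Omega_aff_aut tau : Omega D Pi h tau -> aff_aut D tau.
Proof. by move=> [/(Wext_aff_aut hred)]. Qed.

(** The bound on squared lengths runs along the whole chain, so that equality at its
    two ends forces equality at each step. *)
Lemma bruhat_chain u v tau : Omega D Pi h tau -> aff_aut D u -> bruhat S u v ->
  [/\ aff_aut D v,
    form D (u (tau 0)) (u (tau 0)) <= form D (v (tau 0)) (v (tau 0)) &
    form D (v (tau 0)) (v (tau 0)) <= form D (u (tau 0)) (u (tau 0)) ->
    forall p q, W0 D p -> W0 D q -> (forall y, p (u (tau y)) = q y + toV R mu) ->
    exists p' q', [/\ W0 D p', W0 D q',
     forall y, p' (v (tau y)) = q' y + toV R mu, rchain p p' & rchain q' q]].
Proof.
move=> htau hu; elim=> [|{}v t k l _ [hv le_uv IH] ht hk hl kl].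
  split=> // _ p q hp hq pE; exists p, q.
  by split=> //; apply: rchain_refl.
have [z0 hz0] := A0_nonempty R hPi hh.
have [y0 hy0 tauy] := Omega_A0 htau hz0.
have [a [m [ha vtE z0m vz0m]]] := bruhat_step_side ht hk hl kl hz0.
have vtau := aff_aut_comp hv (Omega_aff_aut htau).
have xm : pairV a ((v \o tau) y0) < m%:~R by rewrite /= tauy.
have [step_le step_eq] := alcove_step vtau hy0 hz0 ha z0m xm.
rewrite vtE /=; split.
- by apply: aff_aut_comp => //; apply: aff_aut_refl.
- exact: le_trans le_uv step_le.
move=> le_vu p q hp hq pE.
have [p' [q' [hp' hq' pE' pp' qq']]] := IH (le_trans step_le le_vu) _ _ hp hq pE.
have [p2 [q2 [hp2 hq2 pE2 pp2 qq2]]] := step_eq (le_trans le_vu le_uv) _ _ hp' hq' pE'.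
exists p2, q2; split=> //; [exact: rchain_trans pp' pp2 | exact: rchain_trans qq2 qq'].
Qed.

(** The chain goes up from [x] to a translation [t_lam]; both translation parts have
    the length of [mu].  A translation written as [p'^-1 t_mu q'] has [p' = q'], so
    the chains from [p] to [p'] and from [q'] to [q] compose. *)
Lemma Adm_rchain (x : 'rV[R]_n -> 'rV[R]_n) p q : Adm R D Pi h mu x -> W0 D p -> W0 D q ->
  (forall y, p (x y) = q y + toV R mu) -> rchain p q.
Proof.
move=> [_ [lam [w hw lamE] [u [v [tau [[hu hv htau uv] [xE tE]]]]]]] hp hq pE.
have [_ _ chain] := bruhat_chain htau (Waff_aff_aut hred hu) uv.
have vtau y : v (tau y) = y + lam by have := congr1 (@^~ y) tE.
have utau y : p (u (tau y)) = q y + toV R mu by rewrite -pE xE.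
have same_norm : form D (v (tau 0)) (v (tau 0)) <= form D (u (tau 0)) (u (tau 0)).
  rewrite vtau add0r lamE (form_W0 _ _ hw) -(form_W0 (u _) _ hp) utau.
  by rewrite (W0_0 hq) add0r.
have [p' [q' [hp' hq' pE' pp' qq']]] := chain same_norm _ _ hp hq utau.
apply: rchain_trans pp' _; suff -> : p' = q' by [].
have p'lam : p' lam = toV R mu.
  by have := pE' 0; rewrite vtau add0r (W0_0 hq') add0r.
apply/funext => y; have := pE' y; rewrite vtau -[lam]scale1r (W0_linear hred hp').
by rewrite !scale1r p'lam => /addIr.
Qed.

End Regular.

End BruhatChain.

(** * The extended affine Weyl group and convex hulls of orbits *)

Section Permissible.
Context (R : realType) (n : nat) (D : root_datum n) (hred : reduced D).
Context (Pi : seq 'rV[int]_n) (hPi : is_base D Pi).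
Context (h : 'rV[int]_n) (hh : is_highest_root D Pi h).
Implicit Types (x y z : 'rV[R]_n) (a b mu : 'rV[int]_n).
Implicit Types (f g s t u v w p q tau : 'rV[R]_n -> 'rV[R]_n).
Local Notation coV a := (toV R (coroot D a)).
Local Notation A0 := (@A0 R n Pi h).

Lemma closure_A0 x : closure A0 x ->
  (forall a, a \in Pi -> 0 <= pairV a x) /\ pairV h x <= 1.
Proof.
have cont b : continuous (fun y : 'rV[R]_n => pairV b y).
  rewrite /pairV /pairing; elim: (index_enum _) => [|i r IH] y.
    rewrite (_ : (fun _ => _) = cst 0); first exact: cst_continuous.
    by apply/funext => z; rewrite big_nil.
  rewrite (_ : (fun _ => _) = (fun z : 'rV[R]_n => toV R b 0 i * z 0 i) \+
      (fun z => \sum_(j <- r) toV R b 0 j * z 0 j)).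
    by apply: cvgD (IH y); apply: cvgMl_tmp; apply: coord_continuous.
  by apply/funext => z; rewrite big_cons.
have sub (C : set 'rV[R]_n) : @closed 'rV[R]_n C -> (A0 `<=` C)%classic ->
    @closure 'rV[R]_n A0 x -> C x.
  by move=> cC AC /(@closure_subset 'rV[R]_n A0 C AC) /cC.
move=> hx; split=> [a ha|].
  apply: (sub ((fun y => pairV a y) @^-1` [set r : R | 0 <= r])%classic) hx.
    by apply: closed_comp => [y _|]; [exact: cont | exact: closed_ge].
  by move=> y [hy _] /=; apply/ltW/hy.
apply: (sub ((fun y => pairV h y) @^-1` [set r : R | r <= 1])%classic) hx.
  by apply: closed_comp => [y _|]; [exact: cont | exact: closed_le].
by move=> y [_ hy] /=; apply: ltW.
Qed.

(** An automorphism of the arrangement that sends one point of [A0] into [A0]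
    preserves [A0], each root having a constant integer part on [A0]. *)
Lemma aff_aut_A0_sub tau x y : aff_aut D tau -> A0 x -> A0 (tau x) -> A0 y -> A0 (tau y).
Proof.
move=> htau hx htx hy.
have cell b : b \in roots D -> exists k : int,
    [/\ k%:~R < pairV b (tau x) < k%:~R + 1 & k%:~R < pairV b (tau y) < k%:~R + 1].
  move=> /(aff_aut_conj_inv htau)[c [m [hc cE _]]]; rewrite !cE.
  have := A0_root hPi hh hx hc; have := A0_root hPi hh hy hc.
  case: (root_pos_or_neg hPi hc) => hcp.
    have := A0_pos hh hx hc hcp; have := A0_pos hh hy hc hcp.
    by exists m; rewrite addrC; lra.
  have := A0_pos hh hx (rootN hc) hcp; have := A0_pos hh hy (rootN hc) hcp.
  by rewrite !pairVNl; exists (m - 1); rewrite rmorphB /=; lra.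
have [tx1 tx2] := htx; split=> [a ha|].
  have [k [c1 c2]] := cell a (Pi_root hPi ha).
  have k1 : (-1)%:~R < k%:~R :> R by rewrite rmorphN /=; have := tx1 a ha; lra.
  have : 0%:~R <= k%:~R :> R by move: k1; rewrite ltr_int ler_int; lia.
  by rewrite rmorph0; lra.
have [k [c1 c2]] := cell h (highest_root hh).
have k1 : k%:~R < 1%:~R :> R by lra.
have : k%:~R <= 0%:~R :> R by move: k1; rewrite ltr_int ler_int; lia.
by rewrite rmorph0; lra.
Qed.

Lemma aff_aut_A0 tau x : aff_aut D tau -> A0 x -> A0 (tau x) ->
  (tau @` A0)%classic = A0.
Proof.
move=> htau hx htx; apply/seteqP; split=> y /=.
  by move=> [z hz <-]; apply: aff_aut_A0_sub hx htx hz.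
have [tau' [tK t'K htau']] := aff_aut_inverse htau.
move=> hy; exists (tau' y); last exact: t'K.
by apply: (aff_aut_A0_sub htau' htx _ hy); rewrite tK.
Qed.

Lemma form_refl_dist a (k : int) x y : a \in roots D ->
  form D (refl D a k x - y) (refl D a k x - y) =
  form D (x - y) (x - y) + (pairV a x - k%:~R) * (pairV a y - k%:~R) * lsq R D a.
Proof.
move=> ha; set c := pairV a x - k%:~R; set d := pairV a y - k%:~R.
have -> : refl D a k x - y = (x - y) - c *: coV a by rewrite /refl addrAC.
have : pairV a (x - y) = c - d by rewrite pairVBr /c /d; ring.
move: (x - y) => z zE.
rewrite formDl !formDr !formNl !formNr !formZl !formZr -/(lsq R D a).
rewrite (formC D z (coV a)); have := form_coroot z ha; rewrite zE.
set e := form D (coV a) z; set L := lsq _ _ _ => e2.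
have -> : e = L * (c - d) / 2 by rewrite -e2; field.
by field.
Qed.

Lemma Wext_refl a (k : int) w : a \in roots D -> Wext D w -> Wext D (refl D a k \o w).
Proof.
move=> ha [lam [v hv ->]]; exists (lam - (pairing a lam - k) *: coroot D a).
exists (refl D a 0 \o v).
  by apply: generated_comp => //; apply: generated_in; exists a.
apply/funext => x; rewrite /trans /refl /= toVD toVN toVZ pairVDr pairV_toV.
by rewrite rmorphB /=; apply/rowP => i; rewrite !mxE; ring.
Qed.

(** As long as [y p] lies outside [A0], a wall of [A0] separates it from [p], and
    reflecting in that wall brings it closer to [p] for the invariant form.  This
    stops because [p] is chosen with rational values on the roots: the squared
    distances then have a common denominator. *)
Lemma Wext_to_A0 (y : 'rV[R]_n -> 'rV[R]_n) : Wext D y ->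
  exists w, [/\ Waff D w & Omega D Pi h (w \o y)].
Proof.
have [rho hrho] := exists_rho R hPi.
have rho_int b : b \in roots D -> exists k : int, pairV b rho = k%:~R.
  have nat_case c0 : nonneg_comb Pi c0 -> exists k : int, pairV c0 rho = k%:~R.
    move=> [c /nonneg_combE ->]; exists (\sum_(a <- Pi) (c a)%:Z).
    rewrite rmorph_sum big_seq [RHS]big_seq; apply: eq_bigr => a /hrho ->.
    by rewrite -mulr_natl mulr1 pmulrn.
  move=> /(root_pos_or_neg hPi)[/nat_case //|/nat_case[k]].
  by rewrite pairVNl => e; exists (- k); rewrite rmorphN /= -e opprK.
have [M hM] := rho_int h (highest_root hh).
have rho_gt0 a : a \in Pi -> 0 < pairV a rho by move=> /hrho ->.
have M_gt0 : 0 < M%:~R + 1 :> R.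
  rewrite -hM; have := nonneg_comb_ge0 (highest_pos R hPi hh) (dominant_gt0 rho_gt0); lra.
pose d : R := M%:~R + 1; pose p := d^-1 *: rho.
have hp : A0 p.
  split=> [a ha|]; rewrite /p pairVZr; first by rewrite mulr_gt0 ?invr_gt0 ?rho_gt0.
  by rewrite hM mulrC ltr_pdivrMr // mul1r /d ltrDl.
have dist_int w : aff_aut D w -> exists k : int,
    d ^+ 2 * form D (w p - p) (w p - p) = k%:~R.
  move=> hw; have coord b : b \in roots D -> exists k : int, d * pairV b (w p - p) = k%:~R.
    move=> hb; have [c [m [hc cE _]]] := aff_aut_conj_inv hw hb.
    have [k hk] := rho_int _ hc; have [l hl] := rho_int _ hb.
    exists (k + m * (M + 1) - l); rewrite pairVBr cE /p !pairVZr hk hl.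
    rewrite rmorphB rmorphD rmorphM rmorphD /= -/d.
    by field; rewrite gt_eqF.
  have coord' b : exists k : int, b \in roots D -> d * pairV b (w p - p) = k%:~R.
    by have [/coord[k ?]|_] := boolP (b \in roots D); [exists k|exists 0].
  have /choice[k hk] := coord'.
  exists (\sum_(b <- undup (roots D)) k b ^+ 2).
  rewrite rmorph_sum /form big_distrr /= big_seq [RHS]big_seq.
  apply: eq_bigr => b; rewrite mem_undup => /hk e.
  by rewrite rmorphXn /= -e; ring.
have key (N : nat) w : Wext D w -> d ^+ 2 * form D (w p - p) (w p - p) < N%:R ->
    exists v, [/\ Waff D v, Wext D (v \o w) & A0 (v (w p))].
  elim: N w => [|N IH] w hw lt_N.
    have : 0 <= d ^+ 2 * form D (w p - p) (w p - p).
      by rewrite mulr_ge0 ?sqr_ge0 ?form_ge0.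
    by move=> ge0; move: lt_N; rewrite ltNge ge0.
  have aw := Wext_aff_aut hred hw.
  have fold a (k : int) : a \in roots D ->
      (pairV a (w p) - k%:~R) * (pairV a p - k%:~R) < 0 ->
      exists v, [/\ Waff D v, Wext D (v \o w) & A0 (v (w p))].
    move=> ha sep; have aw' := aff_aut_comp (aff_aut_refl R hred k ha) aw.
    have [|v [hv hvw hvp]] := IH (refl D a k \o w) (Wext_refl k ha hw).
      have [i hi] := dist_int _ aw; have [j hj] := dist_int _ aw'.
      rewrite hj -[N%:R]/(N%:~R) ltr_int.
      move: lt_N; rewrite hi -[N.+1%:R]/(N.+1%:~R) ltr_int.
      suff: j%:~R < i%:~R :> R by rewrite ltr_int; lia.
      rewrite -hi -hj /= form_refl_dist // mulrDr gtrDl pmulr_rlt0.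
        by rewrite pmulr_llt0 // lsq_gt0.
      by rewrite exprn_gt0.
    exists (v \o refl D a k); split=> //.
    by apply: generated_comp => //; apply: generated_in; exists a => //; exists k.
  have [inA|outA] := pselect (A0 (w p)).
    by exists id; split=> //; apply: generated_id.
  have [/hasP[a ha neg]|/hasPn pos] := boolP (has (fun a => pairV a (w p) < 0) Pi).
    apply: (fold a 0 (Pi_root hPi ha)); rewrite !subr0 nmulr_rlt0 //.
    by case: hp => + _; apply.
  apply: (fold h 1 (highest_root hh)); have [_ hp1] := hp.
  rewrite nmulr_llt0 ?subr_lt0 // subr_gt0 ltNge; apply/negP => le1.
  apply: outA; split=> [a ha|].
    have := pos a ha; rewrite -leNgt le_eqVlt eq_sym.
    by rewrite (negPf (wall_generic hPi hh 0 hp aw (Pi_root hPi ha))).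
  move: le1; rewrite le_eqVlt.
  by rewrite (negPf (wall_generic hPi hh 1 hp aw (highest_root hh))).
move=> hy; have [k hk] := dist_int _ (Wext_aff_aut hred hy).
have [|w [hw hwy hwp]] := key `|k|.+1%N y hy.
  by rewrite hk -[_%:R]/((`|k|.+1)%:~R) ltr_int; lia.
exists w; split=> //; split=> //.
by apply: (aff_aut_A0 (Wext_aff_aut hred hwy) hp hwp).

Qed.

Lemma Wext_decomposition (y : 'rV[R]_n -> 'rV[R]_n) : Wext D y ->
  exists tau, Omega D Pi h tau /\ exists2 w, Waff D w & y = w \o tau.
Proof.
move=> hy; have [w [hw hwy]] := Wext_to_A0 hy.
have [w' [wK w'K _]] := aff_aut_inverse (Waff_aff_aut hred hw).
exists (w \o y); split=> //; exists w'; first exact: generated_inv hw wK w'K.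
by apply/funext => x /=; rewrite wK.
Qed.

Lemma Waff_conj_trans mu f : Waff D f ->
  Waff D (trans (toV R mu) \o f \o trans (- toV R mu)).
Proof.
have tK : cancel (trans (- toV R mu)) (trans (toV R mu)).
  by move=> x; rewrite /trans subrK.
have tK' : cancel (trans (toV R mu)) (trans (- toV R mu)).
  by move=> x; rewrite /trans addrK.
elim=> [|{}f [a ha [k ->]]|{}f g _ hf _ hg|{}f g _ hf fg gf].
- rewrite (_ : _ \o _ = id); first exact: generated_id.
  by apply/funext => x /=; rewrite tK.
- apply: generated_in; exists a => //; exists (k + pairing a mu).
  apply/funext => x; rewrite /= /trans /refl pairVBr pairV_toV rmorphD /=.
  by apply/rowP => i; rewrite !mxE; ring.
- rewrite (_ : _ \o _ = (trans (toV R mu) \o f \o trans (- toV R mu)) \o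
                         (trans (toV R mu) \o g \o trans (- toV R mu))).
    exact: generated_comp.
  by apply/funext => x /=; rewrite tK'.
- apply: generated_inv hf _ _ => x /=; rewrite tK'.
    by rewrite fg tK.
  by rewrite gf tK.
Qed.

Lemma convex_mix (A : set 'rV[R]_n) (c : R) x y : @convex_set R 'rV[R]_n A ->
  0 <= c -> c <= 1 -> A x -> A y -> A (c *: x + (1 - c) *: y).
Proof.
move=> cA c0 c1 Ax Ay; have := cA x y (Itv01 c0 c1).
by rewrite !inE => /(_ Ax Ay).
Qed.

Lemma Conv_W0 mu w x : W0 D w -> Conv D mu x -> Conv D mu (w x).
Proof.
move=> hw hx A [cA orbA]; apply: (hx [set y | A (w y)]%classic); split.
  move=> y z c; rewrite !inE /= => hy hz.
  have wE : w (conv c y z) =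
      conv c (w y : convex_lmodType 'rV[R]_n) (w z : convex_lmodType 'rV[R]_n).
    change (w (c%:inum *: (y : 'rV[R]_n) + (1 - c%:inum) *: (z : 'rV[R]_n)) =
      c%:inum *: w y + (1 - c%:inum) *: w z).
    have wZ := W0_linear hred hw; rewrite wZ; congr (_ + _).
    by have := wZ (c%:inum) 0 y; rewrite !add0r (W0_0 hw) add0r.
  by rewrite wE; have := cA (w y) (w z) c; rewrite !inE; apply.
move=> y [v hv ->] /=; apply: orbA; exists (w \o v) => //.
exact: generated_comp.
Qed.

Lemma Conv_orbit mu w : W0 D w -> Conv D mu (w (toV R mu)).
Proof. by move=> hw A [_ orbA]; apply: orbA; exists w. Qed.

(** The point lies on the segment from [mu] to [s_a mu]. *)
Lemma Conv_segment mu a c : a \in roots D -> 0 <= c <= pairV a (toV R mu) ->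
  Conv D mu (toV R mu - c *: coV a).
Proof.
move=> ha /andP[c0 cle].
have h1 : Conv D mu (toV R mu) by apply: (@Conv_orbit mu id); apply: generated_id.
have h2 : Conv D mu (refl D a 0 (toV R mu)).
  by apply: Conv_orbit; apply: generated_in; exists a.
move=> A hA; have [cA _] := hA.
have [m0|m_neq0] := eqVneq (pairV a (toV R mu)) 0.
  have -> : c = 0 by apply/eqP; rewrite eq_le c0 -m0 cle.
  by rewrite scale0r subr0; apply: h1.
have m_gt0 : 0 < pairV a (toV R mu) by rewrite lt_neqAle eq_sym m_neq0 (le_trans c0).
set m := pairV a _ in cle m_neq0 m_gt0.
have -> : toV R mu - c *: coV a =
    (c / m) *: refl D a 0 (toV R mu) + (1 - c / m) *: toV R mu.
  by rewrite /refl -/m subr0; apply/rowP => i; rewrite !mxE; field.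
apply: convex_mix cA _ _ (h2 A hA) (h1 A hA); first by rewrite divr_ge0 // ltW.
by rewrite ler_pdivrMr // mul1r.
Qed.

Lemma Conv_average4 mu x1 x2 x3 x4 : Conv D mu x1 -> Conv D mu x2 ->
  Conv D mu x3 -> Conv D mu x4 -> Conv D mu (4^-1 *: (x1 + x2 + x3 + x4)).
Proof.
move=> h1 h2 h3 h4 A hA; have [cA _] := hA.
have half x y : A x -> A y -> A (2^-1 *: (x + y)).
  move=> hx hy; have := @convex_mix A 2^-1 x y cA; rewrite invr_ge0 ler0n.
  rewrite (_ : 1 - 2^-1 = 2^-1 :> R); last by field.
  by rewrite -scalerDr; apply=> //; rewrite invf_le1 // ler1n.
have -> : 4^-1 *: (x1 + x2 + x3 + x4) =
    2^-1 *: (2^-1 *: (x1 + x2) + 2^-1 *: (x3 + x4)).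
  by apply/rowP => i; rewrite !mxE; field.
by apply: (half _ _ (half _ _ _ _) (half _ _ _ _)); [apply: h1|apply: h2|apply: h3|apply: h4].
Qed.

End Permissible.

(** * Certificates in rank four *)

Section Certificates.
Implicit Types (M : seq (seq int)) (c r : seq int) (ws : seq nat).

Definition cart M i j : int := nth 0 (nth [::] M i) j.

Definition sum4 (f : nat -> int) : int := f 0%N + f 1%N + f 2%N + f 3%N.

Lemma sum4E f : sum4 f = \sum_(j < 4) f j.
Proof. by rewrite !big_ord_recl big_ord0 /sum4 addr0 !addrA. Qed.

Definition add_at c l (m : int) : seq int :=
  mkseq (fun j => nth 0 c j + (if j == l then m else 0)) 4.

Lemma nth_add_at c l m j : (j < 4)%N ->
  nth 0 (add_at c l m) j = nth 0 c j + (if j == l then m else 0).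
Proof. exact: nth_mkseq. Qed.

(** The entries of [wt_coef M ws i] are the coefficients of
    [omega_i - w omega_i] on the simple coroots, for [w] the product of the
    simple reflections listed in [ws]. *)
Definition wt_step M i l c : seq int :=
  add_at c l ((i == l)%:Z - sum4 (fun j => nth 0 c j * cart M l j)).

Definition wt_coef M ws i : seq int := foldr (wt_step M i) (nseq 4 0) ws.

Lemma nth_wt_coef_cons M l ws i j : (j < 4)%N ->
  nth 0 (wt_coef M (l :: ws) i) j = nth 0 (wt_coef M ws i) j +
    (if j == l then (i == l)%:Z - sum4 (fun k => nth 0 (wt_coef M ws i) k * cart M l k)
     else 0).
Proof. exact: nth_add_at. Qed.

(** A root is recorded with its coroot, as coefficients on the simple ones. *)
Definition reflect_pair M l (rr : seq int * seq int) : seq int * seq int :=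
  (add_at rr.1 l (- sum4 (fun k => nth 0 rr.1 k * cart M k l)),
   add_at rr.2 l (- sum4 (fun k => nth 0 rr.2 k * cart M l k))).

Definition simple_pairs : seq (seq int * seq int) :=
  [seq (add_at [::] l 1, add_at [::] l 1) | l <- iota 0 4].

Definition root_pairs M k : seq (seq int * seq int) :=
  iter k (fun L => undup (L ++ [seq reflect_pair M l rr | l <- iota 0 4, rr <- L]))
    simple_pairs.

Definition closed_pairs M (L : seq (seq int * seq int)) : bool :=
  all (mem L) simple_pairs &&
  all (fun l => all (fun rr => reflect_pair M l rr \in L) L) (iota 0 4).

Definition pair_value M i c r : int :=
  nth 0 r i - sum4 (fun l => nth 0 r l * sum4 (fun j => nth 0 c j * cart M l j)).

Definition le4 c c' : bool := all (fun j => nth 0 c j <= nth 0 c' j) (iota 0 4).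

(** Vectors [c] stand for the weights [omega_i - c], so weights go down as the entries
    go up.  [K] contains every weight met on the way down from [c0] while one
    stays above [c1]; still [c1] is not in [K]. *)
Definition unreachable M L i c0 c1 (K : seq (seq int)) : bool :=
  [&& c0 \in K, c1 \notin K, all (fun c => size c == 4%N) (c1 :: K) &
   all (fun c => all (fun rr : seq int * seq int =>
     let m := pair_value M i c rr.1 in
     let c' := mkseq (fun j => nth 0 c j + m * nth 0 rr.2 j) 4 in
     [&& 0 < m, le4 [::] rr.1 & le4 c' c1] ==>
     (c' \in K)) L) K].

(** The bound 10 on the sums bounds the coefficients of [p x - q x] for all [x] in
    the closed base alcove, where the simple roots take values in [0, 1]. *)
Definition dominates M ps qs : bool :=
  all (fun j => all (fun i => nth 0 (wt_coef M ps i) j <= nth 0 (wt_coef M qs i) j)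
     (iota 0 4) &&
   (sum4 (fun i => nth 0 (wt_coef M qs i) j - nth 0 (wt_coef M ps i) j) <= 10))
   (iota 0 4).

Definition deodhar_cert M L ps qs i K : bool :=
  [&& closed_pairs M L, dominates M ps qs, (i < 4)%N,
      all (fun l => l < 4)%N ps, all (fun l => l < 4)%N qs &
      unreachable M L i (wt_coef M ps i) (wt_coef M qs i) K].

End Certificates.

(** * From certificates to permissible elements that are not admissible *)

Section FourNodes.
Context (R : realType) (n : nat) (D : root_datum n) (hred : reduced D).
Context (Pi : seq 'rV[int]_n) (hPi : is_base D Pi).
Context (bs : seq 'rV[int]_n) (bs_size : size bs = 4%N) (bs_uniq : uniq bs)
  (bsPi : {subset bs <= Pi}) (M : seq (seq int)).
Local Notation b := (nth 0 bs).
Hypothesis cartE : forall i j, (i < 4)%N -> (j < 4)%N ->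
  pairing (b i) (coroot D (b j)) = cart M i j.
Implicit Types (x y z : 'rV[R]_n) (a g : 'rV[int]_n).
Local Notation coV a := (toV R (coroot D a)).

Lemma bPi j : (j < 4)%N -> b j \in Pi.
Proof. by move=> hj; apply/bsPi/mem_nth; rewrite bs_size. Qed.

Lemma b_root j : (j < 4)%N -> b j \in roots D.
Proof. by move=> /bPi/(Pi_root hPi). Qed.

Lemma b_inj i j : (i < 4)%N -> (j < 4)%N -> (b i == b j) = (i == j).
Proof. by move=> hi hj; rewrite nth_uniq ?bs_size. Qed.

Definition word_map (ws : seq nat) : 'rV[R]_n -> 'rV[R]_n :=
  foldr (fun l f => refl D (b l) 0 \o f) id ws.

Lemma word_map_W0 ws : all (fun l => l < 4)%N ws -> W0 D (word_map ws).
Proof.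
elim: ws => [_|l ws IH /= /andP[hl /IH hws]]; first exact: generated_id.
by apply: generated_comp => //; apply: generated_in; exists (b l) => //; apply: b_root.
Qed.

Lemma pairV_b i j : (i < 4)%N -> (j < 4)%N -> pairV (b i) (coV (b j)) = (cart M i j)%:~R.
Proof. by move=> hi hj; rewrite pairV_toV cartE. Qed.

Lemma word_mapE ws x : all (fun l => l < 4)%N ws ->
  word_map ws x = x - \sum_(j < 4)
    (\sum_(i < 4) pairV (b i) x * (nth 0 (wt_coef M ws i) j)%:~R) *: coV (b j).
Proof.
elim: ws => [_|l ws IH hlws].
  rewrite [LHS]/(idfun x) /idfun big1 ?subr0 // => j _; rewrite big1 ?scale0r // => i _.
  by rewrite -[wt_coef _ _ _]/(nseq 4 0) nth_nseq if_same mulr0.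
have /andP[hl /IH {}IH] := hlws.
pose C (j : 'I_4) : R := \sum_(i < 4) pairV (b i) x * (nth 0 (wt_coef M ws i) j)%:~R.
rewrite -[LHS]/(refl D (b l) 0 (word_map ws x)) IH /refl subr0 -/C.
rewrite -addrA -opprD; congr (_ - _).
have -> : pairV (b l) (x - \sum_(j < 4) C j *: coV (b j)) =
    pairV (b l) x - \sum_(j < 4) C j * (cart M l j)%:~R.
  rewrite pairVBr pairV_sumr; congr (_ - _); apply: eq_bigr => j _.
  by rewrite pairVZr pairV_b.
rewrite [RHS](eq_bigr (fun j : 'I_4 => C j *: coV (b j) + (if j == l :> nat then
    (pairV (b l) x - \sum_(k < 4) C k * (cart M l k)%:~R) *: coV (b j) else 0))).
  rewrite big_split /=; congr (_ + _).
  rewrite [RHS](bigD1 (Ordinal hl)) //= eqxx [X in _ = _ + X]big1 ?addr0 // => j.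
  by rewrite -val_eqE /= => /negPf ->.
move=> j _; rewrite /C.
under eq_bigr do rewrite nth_wt_coef_cons // rmorphD /= mulrDr.
rewrite big_split /= scalerDl; congr (_ + _).
have [jl|_] := eqVneq (j : nat) l; last first.
  by rewrite big1 ?scale0r // => i _; rewrite mulr0.
congr (_ *: _); under eq_bigr do rewrite rmorphB /= mulrBr.
rewrite sumrB; congr (_ - _).
  rewrite (bigD1 (Ordinal hl)) //= eqxx mulr1 big1 ?addr0 // => i.
  by rewrite -val_eqE /= => /negPf ->; rewrite mulr0.
rewrite [RHS](eq_bigr (fun k : 'I_4 => \sum_(i < 4) pairV (b i) x *
    (nth 0 (wt_coef M ws i) k)%:~R * (cart M l k)%:~R)) => [|k _]; last first.
  by rewrite big_distrl.
rewrite exchange_big /=; apply: eq_bigr => i _.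
rewrite sum4E rmorph_sum big_distrr /=; apply: eq_bigr => k _.
by rewrite rmorphM /= mulrA.
Qed.

Definition wt x (c : seq int) := x - \sum_(j < 4) (nth 0 c j)%:~R *: coV (b j).

Lemma word_map_wt ws i x : (i < 4)%N -> all (fun l => l < 4)%N ws ->
  (forall j, (j < 4)%N -> pairV (b j) x = (i == j)%:R) ->
  word_map ws x = wt x (wt_coef M ws i).
Proof.
move=> hi hws hx; rewrite word_mapE //; congr (_ - _); apply: eq_bigr => j _.
congr (_ *: _); rewrite (bigD1 (Ordinal hi)) //= hx // eqxx mul1r big1 ?addr0 // => k.
by rewrite hx // -val_eqE /= eq_sym => /negPf ->; rewrite mul0r.
Qed.

Lemma outside_vector : exists x : 'rV[R]_n, forall a, a \in Pi -> pairV a x = (a \notin bs)%:R.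
Proof. exact: (dual_vector hPi (fun a => (a \notin bs)%:R)). Qed.

Lemma pairing_suml (F : 'I_4 -> int) (G : 'I_4 -> 'rV[int]_n) (v : 'rV[int]_n) :
  pairing (\sum_(k < 4) F k *: G k) v = \sum_(k < 4) F k * pairing (G k) v.
Proof.
apply: (@intr_inj R); rewrite -pairV_toV pairV_suml rmorph_sum.
by apply: eq_bigr => k _; rewrite pairVZl rmorphM /= pairV_toV.
Qed.

Lemma pairing_sumr (F : 'I_4 -> int) (G : 'I_4 -> 'rV[int]_n) (v : 'rV[int]_n) :
  pairing v (\sum_(k < 4) F k *: G k) = \sum_(k < 4) F k * pairing v (G k).
Proof.
have pairingC (u w : 'rV[int]_n) : pairing u w = pairing w u.
  by apply: eq_bigr => i _; rewrite mulrC.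
by rewrite pairingC pairing_suml; apply: eq_bigr => k _; rewrite pairingC.
Qed.

Lemma add_at_comb (v : nat -> 'rV[int]_n) r l m : (l < 4)%N ->
  \sum_(k < 4) nth 0 (add_at r l m) k *: v k = \sum_(k < 4) nth 0 r k *: v k + m *: v l.
Proof.
move=> hl; under eq_bigr do rewrite nth_add_at // scalerDl.
rewrite big_split /=; congr (_ + _).
rewrite (bigD1 (Ordinal hl)) //= eqxx big1 ?addr0 // => k.
by rewrite -val_eqE /= => /negPf ->; rewrite scale0r.
Qed.

Lemma srefl_comb (rr : seq int * seq int) l : (l < 4)%N ->
  srefl D (b l) (\sum_(k < 4) nth 0 rr.1 k *: b k) =
  \sum_(k < 4) nth 0 (reflect_pair M l rr).1 k *: b k.
Proof.
move=> hl; rewrite (add_at_comb b) // /srefl scaleNr; congr (_ - _ *: _).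
by rewrite pairing_suml sum4E; apply: eq_bigr => k _; rewrite cartE.
Qed.

Lemma coroot_srefl_comb (rr : seq int * seq int) l : (l < 4)%N ->
  let v := \sum_(k < 4) nth 0 rr.2 k *: coroot D (b k) in
  v - pairing (b l) v *: coroot D (b l) =
  \sum_(k < 4) nth 0 (reflect_pair M l rr).2 k *: coroot D (b k).
Proof.
move=> hl /=; rewrite (add_at_comb (coroot D \o b)) // scaleNr /=; congr (_ - _ *: _).
by rewrite pairing_sumr sum4E; apply: eq_bigr => k _; rewrite cartE.
Qed.

Lemma fundamental j : (j < 4)%N -> exists om : 'rV[R]_n,
  dominant Pi om /\ (forall k, (k < 4)%N -> pairV (b k) om = (k == j)%:R).
Proof.
move=> hj; have [om hom] := dual_vector hPi (fun a => (a == b j)%:R : R).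
exists om; split; first by move=> a /hom ->; rewrite ler0n.
move=> k hk.
by rewrite hom ?bPi // b_inj.
Qed.

(** By induction on the height: a positive root of the subdiagram that is not
    simple is brought down by some simple reflection of the subdiagram. *)
Lemma subdiagram_root (L : seq (seq int * seq int)) (lam : 'rV[R]_n) g :
  closed_pairs M L -> (forall a, a \in Pi -> pairV a lam = (a \notin bs)%:R) ->
  g \in roots D -> nonneg_comb Pi g -> pairV g lam = 0 ->
  exists rr : seq int * seq int, [/\ rr \in L, g = \sum_(j < 4) nth 0 rr.1 j *: b j &
     coroot D g = \sum_(j < 4) nth 0 rr.2 j *: coroot D (b j)].
Proof.
move=> /andP[/allP Lsimple /allP Lclosed] hlam.
have [rho hrho] := exists_rho R hPi.
have rho_ge0 v : nonneg_comb Pi v -> 0 <= pairV v rho.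
  by move=> /nonneg_comb_ge0; apply=> a /hrho ->.
move=> hg gpos; have [N hN] : exists N : nat, pairV g rho < N%:R.
  by eexists; apply: archi_boundP; apply: rho_ge0.
elim: N g hg gpos hN => [|N IH] g hg gpos hN g0.
  by have := rho_ge0 _ gpos; rewrite leNgt hN.
have [c gE] := gpos; have [uPi _ _ _] := hPi.
have c0 a : a \in Pi -> a \notin bs -> c a = 0%N.
  move=> ha abs; move: g0; rewrite (nonneg_combE lam gE) big_seq => /eqP.
  rewrite psumr_eq0 => [/allP/(_ a ha)|d hd].
    by rewrite ha /= hlam // abs pnatr_eq0 => /eqP.
  by rewrite hlam // mulrn_wge0.
have gE4 : g = \sum_(j < 4) (c (b j))%:Z *: b j.
  rewrite {1}gE (bigID (mem bs)) /= [X in _ + X]big_seq_cond [X in _ + X]big1 ?addr0.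
    rewrite -big_filter (perm_big bs) /=.
      rewrite (big_nth 0) big_mkord bs_size; apply: eq_bigr => j _.
      by rewrite -scaler_nat natz.
    apply: uniq_perm; rewrite ?filter_uniq // => a; rewrite mem_filter.
    by apply: andb_idr => /bsPi.
  by move=> a /andP[ha abs]; rewrite c0.
have [j jpos] : exists j : 'I_4, 0 < pairing g (coroot D (b j)).
  apply/existsP; apply/contraT; rewrite negb_exists => /forallP hneg.
  have : pairV g (coV g) <= 0.
    rewrite {1}gE4 pairV_suml; apply: sumr_le0 => j _; rewrite pairVZl.
    apply: mulr_ge0_le0; first by rewrite ler0z.
    have := lsq_sym R (b_root (ltn_ord j)) hg.
    rewrite -pairV_toV => e; rewrite -(pmulr_rle0 _ (lsq_gt0 R (b_root (ltn_ord j)))) e.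
    by rewrite pmulr_rle0 ?lsq_gt0 // lerz0 leNgt.
  by rewrite pairV_corootK // leNgt ltr0n.
have hbj := b_root (ltn_ord j); have hbPi := bPi (ltn_ord j).
have [gb|gb] := eqVneq g (b j).
  exists (add_at [::] j 1, add_at [::] j 1).
  split.
  - apply: Lsimple; apply: (map_f (fun l => (add_at [::] l 1, add_at [::] l 1))).
    by rewrite mem_iota /= ltn_ord.
  - by rewrite (add_at_comb b) // big1 ?add0r ?scale1r // => k _; rewrite nth_nil scale0r.
  - rewrite gb (add_at_comb (coroot D \o b)) // big1 ?add0r ?scale1r // => k _.
    by rewrite nth_nil scale0r.
have spos := simple_srefl_pos R hred hPi hbPi hg gpos gb.
have sroot := srefl_root hbj hg.
have s_rho x : pairV (srefl D (b j) g) x =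
    pairV g x - (pairing g (coroot D (b j)))%:~R * pairV (b j) x.
  by rewrite /srefl pairVBl pairVZl.
have [||rr [rrL gr gv]] := IH _ sroot spos.
- have m1 : 1 <= (pairing g (coroot D (b j)))%:~R :> R by rewrite ler1z; lia.
  by rewrite s_rho (hrho _ hbPi) mulr1; move: hN m1; rewrite -natr1; lra.
- by rewrite s_rho g0 hlam // mem_nth ?bs_size // mulr0 subr0.
exists (reflect_pair M j rr); split.
- have jL : (j : nat) \in iota 0 4 by rewrite mem_iota /= ltn_ord.
  by have /allP/(_ _ rrL) := Lclosed j jL.
- by rewrite -(sreflK R hbj g) gr srefl_comb.
- by rewrite -(sreflK R hbj g) (coroot_srefl R) // gv coroot_srefl_comb.
Qed.

Lemma refl_wt x c g (rr : seq int * seq int) i : (i < 4)%N ->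
  (forall j, (j < 4)%N -> pairV (b j) x = (i == j)%:R) ->
  g = \sum_(j < 4) nth 0 rr.1 j *: b j ->
  coroot D g = \sum_(j < 4) nth 0 rr.2 j *: coroot D (b j) ->
  let m := pair_value M i c rr.1 in
  pairV g (wt x c) = m%:~R /\
  refl D g 0 (wt x c) = wt x (mkseq (fun j => nth 0 c j + m * nth 0 rr.2 j) 4).
Proof.
move=> hi hx gE gV m.
have mE : pairV g (wt x c) = m%:~R.
  rewrite pairVBr pairV_sumr /m /pair_value rmorphB /= {1}gE pairV_suml.
  congr (_ - _).
    rewrite (bigD1 (Ordinal hi)) //= pairVZl hx // eqxx mulr1 big1 ?addr0 // => k.
    by rewrite pairVZl hx // -val_eqE /= eq_sym => /negPf ->; rewrite mulr0.
  rewrite sum4E rmorph_sum /=.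
  transitivity (\sum_(j < 4) \sum_(k < 4)
      (nth 0 c j)%:~R * (nth 0 rr.1 k)%:~R * (cart M k j)%:~R : R).
    apply: eq_bigr => j _; rewrite pairVZr gE pairV_suml big_distrr /=.
    by apply: eq_bigr => k _; rewrite pairVZl pairV_b // mulrA.
  rewrite exchange_big /=; apply: eq_bigr => k _.
  rewrite sum4E rmorphM rmorph_sum /= big_distrr /=; apply: eq_bigr => j _.
  by rewrite rmorphM /=; ring.
split=> //; rewrite /refl mE subr0 gV /wt -addrA -opprD; congr (_ - _).
under [RHS]eq_bigr do rewrite nth_mkseq // rmorphD rmorphM scalerDl -scalerA.
rewrite big_split /= -scaler_sumr; congr (_ + _ *: _).
elim/big_rec2: _ => [|j y z _ <-]; first exact: toV0.
by rewrite toVD toVZ.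
Qed.

Lemma form_wt lam x c :
  form D lam (wt x c) = form D lam x -
    \sum_(j < 4) (nth 0 c j)%:~R * (lsq R D (b j) / 2 * pairV (b j) lam).
Proof.
rewrite /wt formDr formNr [form D lam (\sum_(_ < _) _)]formC form_suml; congr (_ - _).
apply: eq_bigr => j _; rewrite formZl; congr (_ * _).
by rewrite mulrAC -form_coroot ?b_root //; field.
Qed.

Lemma form_wt_fundamental j om x c : (j < 4)%N ->
  (forall k, (k < 4)%N -> pairV (b k) om = (k == j)%:R) ->
  form D om (wt x c) = form D om x - (nth 0 c j)%:~R * (lsq R D (b j) / 2).
Proof.
move=> hj hom; rewrite form_wt (bigD1 (Ordinal hj)) //= hom // eqxx mulr1 big1 ?addr0 // => k.
by rewrite hom // -val_eqE /= => /negPf ->; rewrite !mulr0.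
Qed.

(** [K] traps the chain: a step through a root outside the subdiagram would lose
    something in a direction where [p x] and [q x] agree, and a step through
    a root of the subdiagram stays in [K] because the rest of the chain only
    goes further down. *)
Lemma rchain_trapped L i c1 (K : seq (seq int)) p q x : closed_pairs M L -> (i < 4)%N ->
  (forall a, a \in Pi -> pairV a x = (b i == a)%:R) ->
  (forall c, c \in K -> forall rr : seq int * seq int, rr \in L ->
     let m := pair_value M i c rr.1 in
     let c' := mkseq (fun j => nth 0 c j + m * nth 0 rr.2 j) 4 in
     0 < m -> le4 [::] rr.1 -> le4 c' c1 -> c' \in K) ->
  rchain D Pi p q -> q x = wt x c1 -> (exists2 c, c \in K & p x = wt x c) ->
  exists2 c, c \in K & q x = wt x c.
Proof.
move=> hL hi hx Kclosed pq qx.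
have [lam hlam] := outside_vector.
have hxb j : (j < 4)%N -> pairV (b j) x = (i == j)%:R.
  by move=> hj; rewrite hx ?bPi // b_inj.
have x_dom : dominant Pi x by move=> a /hx ->; rewrite ler0n.
have lam_dom : dominant Pi lam by move=> a /hlam ->; rewrite ler0n.
have form_lam c : form D lam (wt x c) = form D lam x.
  rewrite form_wt big1 ?subr0 // => j _.
  by rewrite hlam ?bPi // mem_nth ?bs_size // !mulr0.
elim: pq qx => // {}p {}q g hg gpos hp pq IH qx [c cK px].
apply: IH => //=.
set m := pairV g (p x).
have m0 : 0 <= m by apply: hp.
have reflE : refl D g 0 (p x) = p x - m *: coV g by rewrite /refl subr0.
have [mz|mnz] := eqVneq m 0; first by exists c; rewrite // reflE mz scale0r subr0.
have m_gt0 : 0 < m by rewrite lt_neqAle eq_sym mnz.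
have le_p y : dominant Pi y -> form D y (wt x c1) <= form D y (refl D g 0 (p x)).
  by move=> y_dom; have := rchain_form pq x_dom y_dom; rewrite /= qx.
have glam : pairV g lam = 0.
  apply/eqP; rewrite eq_le (nonneg_comb_ge0 gpos lam_dom) andbT.
  have := le_p _ lam_dom; rewrite reflE px formDr !form_lam lerDl formNr oppr_ge0.
  rewrite formZr pmulr_rle0 // formC => le0.
  by rewrite -(pmulr_rle0 _ (lsq_gt0 R hg)) -form_coroot // pmulr_rle0.
have [rr [rrL gE gV]] := subdiagram_root hL hlam hg gpos glam.
have [mE rE] := refl_wt c hi hxb gE gV.
have mint : m = (pair_value M i c rr.1)%:~R by rewrite /m px mE.
exists (mkseq (fun j => nth 0 c j + pair_value M i c rr.1 * nth 0 rr.2 j) 4).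
  apply: (Kclosed c cK rr rrL).
  - by rewrite -(ltr0z R) -mint.
  - apply/allP => j; rewrite mem_iota nth_nil /= => hj; rewrite -(ler0z R).
    have [om [om_dom hom]] := fundamental hj.
    suff <- : pairV g om = (nth 0 rr.1 j)%:~R by exact: nonneg_comb_ge0 gpos om_dom.
    rewrite gE pairV_suml (bigD1 (Ordinal hj)) //= pairVZl hom // eqxx mulr1.
    rewrite big1 ?addr0 // => k kj.
    by move: kj; rewrite pairVZl hom // -val_eqE /= => /negPf ->; rewrite mulr0.
  - apply/allP => j; rewrite mem_iota /= => hj; rewrite -(ler_int R).
    have [om [om_dom hom]] := fundamental hj.
    have := le_p _ om_dom; rewrite px rE !(form_wt_fundamental _ _ hj hom) lerD2l lerN2 ler_pM2r //.
    by rewrite divr_gt0 ?lsq_gt0 ?b_root.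
by rewrite px rE.
Qed.

Lemma wt_inj x c c' : wt x c = wt x c' ->
  forall j, (j < 4)%N -> nth 0 c j = nth 0 c' j.
Proof.
move=> e j hj; have [om [_ hom]] := fundamental hj.
have l2 : lsq R D (b j) / 2 != 0 by rewrite gt_eqF // divr_gt0 ?lsq_gt0 ?b_root.
have := congr1 (form D om) e; rewrite !(form_wt_fundamental _ _ hj hom).
by move=> /addrI/oppr_inj/(mulIf l2)/intr_inj.
Qed.

Lemma cert_not_rchain L ps qs i K : deodhar_cert M L ps qs i K ->
  ~ rchain D Pi (word_map ps) (word_map qs).
Proof.
case/and5P=> hL _ hi hps /andP[hqs /and4P[c0K c1K /allP szK /allP Kclosed]] chain.
have [x hx] := dual_vector hPi (fun a => (b i == a)%:R : R).
have hxb j : (j < 4)%N -> pairV (b j) x = (i == j)%:R.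
  by move=> hj; rewrite hx ?bPi // b_inj.
have px := word_map_wt hi hps hxb; have qx := word_map_wt hi hqs hxb.
have start : exists2 c, c \in K & word_map ps x = wt x c by exists (wt_coef M ps i).
have [|c cK] := rchain_trapped hL hi hx _ chain qx start.
  move=> c cK rr rrL m c' m0 r0 le_c'; have /allP/(_ _ rrL) := Kclosed c cK.
  by rewrite /= -/m m0 r0 le_c' => /implyP; apply.
rewrite qx => /wt_inj e; move/negP: c1K; apply.
suff -> : wt_coef M qs i = c by [].
have sz d : d \in wt_coef M qs i :: K -> size d = 4%N by move=> /szK/eqP.
apply: (@eq_from_nth _ 0) => [|j]; rewrite !sz ?mem_head ?in_cons ?cK ?orbT //.
exact: e.
Qed.

Lemma cert_dominates L ps qs i K x : deodhar_cert M L ps qs i K ->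
  (forall j, (j < 4)%N -> 0 <= pairV (b j) x <= 1) ->
  exists f : nat -> R, (forall j, (j < 4)%N -> 0 <= f j <= 10) /\
    word_map ps x - word_map qs x = \sum_(j < 4) f j *: coV (b j).
Proof.
case/and5P=> _ /allP dom hi hps /andP[hqs _] hx.
pose e i' j : int := nth 0 (wt_coef M qs i') j - nth 0 (wt_coef M ps i') j.
exists (fun j => \sum_(k < 4) pairV (b k) x * (e k j)%:~R); split=> [j hj|].
  have /dom/andP[/allP ge0 le10] : j \in iota 0 4 by rewrite mem_iota.
  have e_ge0 (k : 'I_4) : 0 <= (e k j)%:~R :> R.
    by rewrite ler0z subr_ge0; apply: ge0; rewrite mem_iota /= ltn_ord.
  apply/andP; split.
    by apply: sumr_ge0 => k _; apply: mulr_ge0 => //; have /andP[] := hx k (ltn_ord k).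
  move: le10; rewrite sum4E -(ler_int R) rmorph_sum /=; apply: le_trans.
  apply: ler_sum => k _; apply: ler_piMl (e_ge0 k) _.
  by have /andP[] := hx k (ltn_ord k).
rewrite !word_mapE // opprD opprK addrACA subrr add0r addrC -sumrB.
apply: eq_bigr => j _; rewrite -scalerBl -sumrB; congr (_ *: _).
by apply: eq_bigr => k _; rewrite -mulrBr rmorphB.
Qed.

(** The element [p^-1 t_mu q] is not admissible, because no chain leads from [p] to
    [q].  It is permissible: at a point [y] of the closed base alcove, one has to
    find [mu - (p y - q y)] in the convex hull, and this is the average of the
    four points [mu - 4 f_j b_j^vee], each of them on the segment from [mu] to its
    reflection since [4 f_j <= 40]. *)
Lemma cert_Adm_neq_Perm h L ps qs i K mu : is_highest_root D Pi h ->
  deodhar_cert M L ps qs i K -> (forall a, a \in Pi -> 40 <= pairing a mu) ->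
  Adm R D Pi h mu <> Perm R D Pi h mu.
Proof.
move=> hh cert hmu AP; set p := word_map ps; set q := word_map qs.
have [_ _ _ hps /andP[hqs _]] := and5P cert.
have hp := word_map_W0 hps; have hq := word_map_W0 hqs.
have [pinv [hpinv pK pinvK]] := W0_inv hred hp.
pose x := pinv \o (trans (toV R mu) \o q).
apply: (cert_not_rchain cert).
have mu_reg a : a \in Pi -> 1 <= pairing a mu by move=> /hmu; lia.
suff xA : Adm R D Pi h mu x.
  by apply: (Adm_rchain hred hPi hh mu_reg xA hp hq) => y; rewrite /x /= pinvK.
rewrite AP; split.
  have tmu : Wext D (trans (toV R mu)).
    by exists mu; exists id => //; apply: generated_id.
  have [tau [htau [w hw tE]]] := Wext_decomposition hred hPi hh tmu.
  exists tau; split=> //; first by exists w.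
  exists (pinv \o ((trans (toV R mu) \o q \o trans (- toV R mu)) \o w)).
    apply: generated_comp; first exact: W0_Waff.
    by apply: generated_comp => //; apply: Waff_conj_trans => //; apply: W0_Waff.
  apply/funext => y; rewrite /x /=; have <- : trans (toV R mu) y = w (tau y) by rewrite tE.
  by rewrite /trans addrK.
move=> y [/closure_A0[y_dom y_h] _].
have [|f [f_bd fE]] := cert_dominates (x := y) cert.
  move=> j hj; rewrite y_dom ?bPi //=.
  exact: le_trans (highest_ge hh (b_root hj) y_dom) y_h.
have -> : x y - y = pinv (toV R mu - \sum_(j < 4) f j *: coV (b j)).
  have -> : toV R mu - \sum_(j < 4) f j *: coV (b j) = (q y + toV R mu) + (-1) *: p y.
    by rewrite -fE opprB addrCA addrA scaleN1r.
  by rewrite (W0_linear hred hpinv) pK scaleN1r.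
apply: Conv_W0 => //.
pose z j := toV R mu - (4 * f j) *: coV (b j).
have -> : toV R mu - \sum_(j < 4) f j *: coV (b j) = 4^-1 *: (z 0%N + z 1%N + z 2%N + z 3%N).
  rewrite !big_ord_recl big_ord0 /z /=.
  by apply/rowP => k; rewrite !mxE; field.
have hz j : (j < 4)%N -> Conv D mu (z j).
  move=> hj; apply: Conv_segment; first exact: b_root.
  have /andP[f0 f10] := f_bd j hj; have := hmu _ (bPi hj).
  by rewrite pairV_toV -(ler_int R) => hm; apply/andP; split; lra.
by apply: Conv_average4; apply: hz.
Qed.

End FourNodes.

(** * The four subdiagrams *)

(** The double bond is between nodes 0 and 1 for types B and C, between nodes 1 and 2
    for type F; node 0 is the centre for type D. *)
Definition cartan_BC (k l : int) : seq (seq int) :=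
  [:: [:: 2; k; 0; 0]; [:: l; 2; -1; 0]; [:: 0; -1; 2; -1]; [:: 0; 0; -1; 2]].
Definition cartan_D : seq (seq int) :=
  [:: [:: 2; -1; -1; -1]; [:: -1; 2; 0; 0]; [:: -1; 0; 2; 0]; [:: -1; 0; 0; 2]].
Definition cartan_F (k l : int) : seq (seq int) :=
  [:: [:: 2; -1; 0; 0]; [:: -1; 2; k; 0]; [:: 0; l; 2; -1]; [:: 0; 0; -1; 2]].

(** In types B, C and D, and up to a vector orthogonal to the subdiagram, [p omega_i]
    is a coroot [alpha] and [q omega_i] is [- gamma], for two orthogonal positive
    coroots of the same length: losing [alpha + gamma] in all, one cannot pass from
    the one to the other by reflections.  In type F the pair comes from an
    enumeration of the Weyl group.  Eleven rounds produce all the roots, because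
    the highest root of type F has height 11. *)
Lemma cert_B : deodhar_cert (cartan_BC (-2) (-1))
  (root_pairs (cartan_BC (-2) (-1)) 11) [:: 2; 3; 1; 2]%N
  [:: 3; 2; 1; 0; 1; 2; 3]%N 2 [:: [:: 0; 1; 2; 1]; [:: 2; 1; 2; 1]].
Proof. by vm_compute. Qed.
Lemma cert_C : deodhar_cert (cartan_BC (-1) (-2))
  (root_pairs (cartan_BC (-1) (-2)) 11) [:: 2; 3; 1; 2]%N
  [:: 3; 2; 1; 0; 1; 2; 3]%N 2 [:: [:: 0; 1; 2; 1]; [:: 1; 1; 2; 1]].
Proof. by vm_compute. Qed.
Lemma cert_D : deodhar_cert cartan_D
  (root_pairs cartan_D 11) [:: 0; 3; 2; 0]%N
  [:: 3; 0; 2; 1; 0; 3]%N 0 [:: [:: 2; 0; 1; 1]].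
Proof. by vm_compute. Qed.
Lemma cert_F1 : deodhar_cert (cartan_F (-2) (-1))
  (root_pairs (cartan_F (-2) (-1)) 11) [:: 1; 2; 0; 1]%N
  [:: 0; 1; 2; 3; 1; 2; 1; 0]%N 1
  [:: [:: 1; 3; 1; 1]; [:: 2; 3; 1; 1]; [:: 2; 3; 1; 0]; [:: 2; 3; 2; 0];
      [:: 1; 3; 1; 0]; [:: 1; 3; 2; 0]].
Proof. by vm_compute. Qed.
Lemma cert_F2 : deodhar_cert (cartan_F (-1) (-2))
  (root_pairs (cartan_F (-1) (-2)) 11) [:: 1; 2; 0; 1]%N
  [:: 0; 1; 2; 3; 1; 2; 1; 0]%N 1
  [:: [:: 1; 3; 2; 2]; [:: 2; 3; 4; 0]; [:: 2; 3; 2; 0]; [:: 1; 3; 4; 0];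
      [:: 1; 3; 2; 0]; [:: 2; 3; 2; 2]].
Proof. by vm_compute. Qed.

(** * Connectedness and positivity of the Dynkin diagram *)

Section Subdiagram.
Context (R : realType) (n : nat) (D : root_datum n) (hred : reduced D).
Context (Pi : seq 'rV[int]_n) (hPi : is_base D Pi).
Implicit Types (a b c : 'rV[int]_n) (s ls : seq 'rV[int]_n) (x y z : 'rV[R]_n).
Local Notation coV a := (toV R (coroot D a)).
Local Notation N a b := (pairing a (coroot D b)).

(** Vectors of length zero lie in the radical of the form. *)
Lemma form_gt0 y x : form D y x != 0 -> 0 < form D y y.
Proof.
move=> yx; rewrite lt_neqAle form_ge0 andbT eq_sym.
apply: contraNneq yx => /form_eq0 y0; apply/eqP.
rewrite /form big_seq big1 // => g; rewrite mem_undup => /y0 ->.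
by rewrite mul0r.
Qed.

Lemma simple_pairing_le0 a b : a \in Pi -> b \in Pi -> a != b -> N a b <= 0.
Proof.
move=> ha hb ab; have [x hx] := dual_vector hPi (fun g => (g == b)%:R : R).
have [rb ra] := (Pi_root hPi hb, Pi_root hPi ha).
have spos := simple_srefl_pos R hred hPi hb ra (simple_pos hPi ha) ab.
have x_dom : dominant Pi x by move=> g /hx ->; rewrite ler0n.
have := nonneg_comb_ge0 spos x_dom.
rewrite /srefl pairVBl pairVZl !hx // eqxx (negPf ab) mulr1 sub0r oppr_ge0.
by rewrite lerz0.
Qed.

Lemma pairing_eq0_sym a b : a \in roots D -> b \in roots D -> (N a b == 0) = (N b a == 0).
Proof.
move=> ha hb; have := lsq_sym R ha hb => e.
have [la lb] := (lsq_gt0 R ha, lsq_gt0 R hb).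
apply/eqP/eqP => n0; move: e; rewrite n0 mulr0 => /eqP.
  by rewrite eq_sym mulf_eq0 gt_eqF //= intr_eq0 => /eqP.
by rewrite mulf_eq0 gt_eqF //= intr_eq0 => /eqP.
Qed.

Lemma pairing_le0_sym a b : a \in roots D -> b \in roots D -> (N a b <= 0) = (N b a <= 0).
Proof.
move=> ha hb; rewrite -(lerz0 R) -(pmulr_rle0 _ (lsq_gt0 R ha)) (lsq_sym R ha hb).
by rewrite pmulr_rle0 ?lsq_gt0 // lerz0.
Qed.

(** Otherwise every root would be supported on one of the two orthogonal pieces
    of the base. *)
Lemma base_connected (P : pred 'rV[int]_n) : irreducible D ->
  (exists2 a, a \in Pi & P a) -> (exists2 b, b \in Pi & ~~ P b) ->
  exists a b, [/\ a \in Pi, b \in Pi, P a, ~~ P b & N a b != 0].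
Proof.
move=> [_ irr] [a0 a0Pi Pa0] [b0 b0Pi Pb0].
have [//|none] := pselect (exists a b, [/\ a \in Pi, b \in Pi, P a, ~~ P b & N a b != 0]).
have orth a b : a \in Pi -> b \in Pi -> P a -> ~~ P b -> N a b = 0 /\ N b a = 0.
  move=> ha hb Pa Pb; have ab0 : N a b = 0.
    by apply/eqP/negPn/negP => ab; apply: none; exists a, b.
  by split=> //; apply/eqP; rewrite -pairing_eq0_sym ?ab0 // (Pi_root hPi).
have [inP hinP] := dual_vector hPi (fun a => (P a)%:R : R).
have [notP hnotP] := dual_vector hPi (fun a => (~~ P a)%:R : R).
have [rho hrho] := exists_rho R hPi.
have rho_ge0 v : nonneg_comb Pi v -> 0 <= pairV v rho.
  by move=> /nonneg_comb_ge0; apply=> a /hrho ->.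
have rho_gt0 b : b \in Pi -> 0 < pairV b rho by move=> /hrho ->.
have orth_supp (Q : pred 'rV[int]_n) x g a :
    (forall b, b \in Pi -> pairV b x = (Q b)%:R) -> nonneg_comb Pi g -> pairV g x = 0 ->
    (forall b, b \in Pi -> ~~ Q b -> N b a = 0) -> N g a = 0.
  move=> hx [c gE]; rewrite (nonneg_combE x gE) big_seq => /eqP.
  rewrite psumr_eq0 => [/allP c0 hN|b hb]; last by rewrite hx // mulrn_wge0.
  apply/(@intr_inj R); rewrite -pairV_toV (nonneg_combE _ gE) big_seq big1 // => b hb.
  rewrite pairV_toV; have := c0 b hb; rewrite hb hx //= mulrn_eq0.
  by case: (boolP (Q b)) => [_|/(hN b hb) -> _]; rewrite ?oner_eq0 ?mul0rn // orbF => /eqP ->.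
(* By induction on the height: reflecting in a simple root [a] with positive pairing
   gives a lower root that still pairs nontrivially with [a], so that [a] lies on
   the side of that root. *)
have one_side g : g \in roots D -> nonneg_comb Pi g -> pairV g inP = 0 \/ pairV g notP = 0.
  move=> hg gpos; have [m hm] : exists m : nat, pairV g rho < m%:R.
    by eexists; apply: archi_boundP; apply: rho_ge0.
  elim: m g hg gpos hm => [|m IH] g hg gpos hm.
    by have := rho_ge0 _ gpos; rewrite leNgt hm.
  have [c gE] := gpos.
  have [a ha apos] : exists2 a, a \in Pi & 0 < N g a.
    apply/hasP; apply: contraT => /hasPn hneg.
    have : pairV g (coV g) <= 0.
      rewrite (nonneg_combE _ gE) big_seq; apply: sumr_le0 => a ha.
      apply: mulrn_wle0; rewrite pairV_toV lerz0.
      by rewrite -(pairing_le0_sym hg (Pi_root hPi ha)) leNgt; apply: hneg.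
    by rewrite pairV_corootK // leNgt ltr0n.
  have [->|ga] := eqVneq g a.
    by rewrite hinP ?hnotP //; case: (P a); [right|left].
  have ra := Pi_root hPi ha.
  have sE x : pairV (srefl D a g) x = pairV g x - (N g a)%:~R * pairV a x.
    by rewrite /srefl pairVBl pairVZl.
  have spos := simple_srefl_pos R hred hPi ha hg gpos ga.
  have sN : N (srefl D a g) a != 0.
    rewrite -(intr_eq0 R) -pairV_toV sE pairV_corootK // pairV_toV.
    by rewrite -[2]/(2%:~R) -rmorphM -rmorphB intr_eq0; lia.
  have s_lt : pairV (srefl D a g) rho < m%:R.
    have m1 : 1 <= (N g a)%:~R :> R by rewrite ler1z; lia.
    by rewrite sE (hrho _ ha) mulr1; move: hm m1; rewrite -natr1; lra.
  case: (IH _ (srefl_root ra hg) spos s_lt) => s0; [left|right].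
    case: (boolP (P a)) => Pa.
      move/negP: sN; case; apply/eqP; apply: (orth_supp _ _ _ _ hinP spos s0) => b hb Pb.
      by have [] := orth a b ha hb Pa Pb.
    by move: s0; rewrite sE (hinP _ ha) (negPf Pa) mulr0 subr0.
  case: (boolP (P a)) => Pa; first by move: s0; rewrite sE (hnotP _ ha) Pa mulr0 subr0.
  move/negP: sN; case; apply/eqP; apply: (orth_supp _ _ _ _ hnotP spos s0) => b hb.
  by rewrite negbK => Pb; have [] := orth b a hb ha Pb Pa.
have orth_pos a b : a \in roots D -> b \in roots D -> nonneg_comb Pi a ->
    nonneg_comb Pi b -> pairV a notP = 0 -> pairV b inP = 0 -> N a b = 0.
  move=> ra rb apos bpos az bz; apply: (orth_supp _ _ _ _ hnotP apos az) => p hp.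
  rewrite negbK => Pp; apply/eqP; rewrite (pairing_eq0_sym (Pi_root hPi hp) rb); apply/eqP.
  apply: (orth_supp _ _ _ _ hinP bpos bz) => p' hp' Pp'.
  by have [] := orth p p' hp hp' Pp Pp'.
have pos_rep g : g \in roots D -> exists e : int, [/\ e = 1 \/ e = -1,
    e *: g \in roots D, nonneg_comb Pi (e *: g) & coV (e *: g) = e%:~R *: coV g].
  move=> hg; case: (root_pos_or_neg hPi hg) => hc.
    by exists 1; rewrite !scale1r; split=> //; left.
  exists (-1); rewrite !scaleN1r (corootN R hred hg) toVN rootN //.
  by split=> //; right.
exfalso; apply: irr; exists (fun g => pairV g notP == 0); split.
- by exists a0; [apply: (Pi_root hPi a0Pi) | rewrite hnotP // Pa0].
- by exists b0; [apply: (Pi_root hPi b0Pi) | rewrite hnotP // Pb0 oner_eq0].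
move=> a b ra rb az bN0.
have [e [e1 era epos eV]] := pos_rep a ra; have [f [f1 frb fpos fV]] := pos_rep b rb.
have ea0 : pairV (e *: a) notP = 0 by rewrite pairVZl (eqP az) mulr0.
have fb0 : pairV (f *: b) inP = 0.
  case: (one_side _ frb fpos) => // /eqP; rewrite pairVZl mulf_eq0 (negPf bN0) orbF.
  by rewrite intr_eq0; case: f1 => ->.
have := orth_pos _ _ era frb epos fpos ea0 fb0.
move/(congr1 (fun k : int => k%:~R : R)); rewrite -pairV_toV fV pairVZl pairVZr pairV_toV.
rewrite -!rmorphM => /intr_inj; lia.
Qed.

Definition simply_laced_path s := forall i j, (i < size s)%N -> (j < size s)%N ->
  N (nth 0 s i) (nth 0 s j) =
    if i == j then 2 else if (i.+1 == j) || (j.+1 == i) then -1 else 0.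

Lemma path_uniq s : {subset s <= Pi} -> simply_laced_path s -> uniq s.
Proof.
move=> sPi hs; apply/(uniqP 0) => i j; rewrite !inE => hi hj e.
have := hs i j hi hj; rewrite e (pairing_coroot (Pi_root hPi (sPi _ (mem_nth 0 hj)))).
by case: eqP => // _; case: ifP.
Qed.

Lemma form_simple a b : a \in Pi -> form D (coV a) (coV b) = lsq R D a / 2 * (N a b)%:~R.
Proof.
by move=> ha; rewrite mulrAC -pairV_toV -(form_coroot _ (Pi_root hPi ha)); field.
Qed.

Lemma path_lsq s i : {subset s <= Pi} -> simply_laced_path s -> (i < size s)%N ->
  lsq R D (nth 0 s i) = lsq R D (nth 0 s 0).
Proof.
move=> sPi hs; elim: i => // i IH hi; rewrite -IH 1?ltnW //.
have ri k : (k < size s)%N -> nth 0 s k \in roots D by move=> /(mem_nth 0)/sPi/(Pi_root hPi).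
have := lsq_sym R (ri _ hi) (ri _ (ltnW hi)).
rewrite !hs ?(ltnW hi) // !eqxx orbT /= gtn_eqF // ltn_eqF // !mulrN1.
exact: oppr_inj.
Qed.

(** These sums are the coroots obtained from the first one by successive simple
    reflections, hence have its length. *)
Lemma path_form s m : {subset s <= Pi} -> simply_laced_path s -> (m < size s)%N ->
  let y := \sum_(i < m.+1) coV (nth 0 s i) in form D y y = lsq R D (nth 0 s 0).
Proof.
move=> sPi hs; elim: m => [|m IH] hm y; first by rewrite /y big_ord_recl big_ord0 addr0.
rewrite /y big_ord_recr /= formDl !formDr (formC D (coV _)) IH 1?ltnW // -/(lsq R D _).
rewrite (path_lsq sPi hs hm) form_suml big_ord_recr /= big1 ?add0r => [|i _].
  rewrite form_simple ?sPi ?mem_nth 1?ltnW // (hs _ _ (ltnW hm) hm) ltn_eqF // eqxx /=.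
  by rewrite (path_lsq sPi hs (ltnW hm)) rmorphN /=; field.
have im : (i < m)%N := ltn_ord i.
have im' : (i < size s)%N by apply: ltn_trans im (ltnW hm).
rewrite form_simple ?sPi ?mem_nth // hs //.
case: eqP => [|_]; first lia.
by case: ifP => [|_]; [lia | rewrite mulr0].
Qed.

(** Completing the square: subtracting from the sum [y] of the coroots of the path
    its projections to the coroots of the leaves gives a combination with
    nonnegative coefficients, of squared length at most
    [lsq * (1 - (the sum) / 4)], which has to be positive. *)
Lemma branch_bound s ls : {subset s <= Pi} -> simply_laced_path s -> (0 < size s)%N ->
  uniq ls -> {subset ls <= Pi} -> (forall a, a \in ls -> a \notin s) ->
  \sum_(a <- ls) (\sum_(c <- s) N a c) * (\sum_(c <- s) N c a) < 4.
Proof.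
move=> sPi hs s_gt0 uls lsPi disj.
have [rho hrho] := exists_rho R hPi.
pose X a : R := (\sum_(c <- s) N a c)%:~R; pose Y a : R := (\sum_(c <- s) N c a)%:~R.
pose y : 'rV[R]_n := \sum_(c <- s) coV c.
pose t a : R := - X a / 2; pose z := \sum_(a <- ls) t a *: coV a.
set L := lsq R D (nth 0 s 0).
have L_gt0 : 0 < L by apply/lsq_gt0/(Pi_root hPi)/sPi/mem_nth.
have yE : form D y y = L.
  rewrite /y (big_nth 0) big_mkord; move: (@path_form s (size s).-1 sPi hs).
  by rewrite prednK //; apply.
have la a : a \in Pi -> 0 < lsq R D a by move=> ha; apply/lsq_gt0/(Pi_root hPi).
have ay a : a \in Pi -> form D (coV a) y = lsq R D a / 2 * X a.
  move=> ha; rewrite formC /y form_suml /X rmorph_sum big_distrr /=.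
  by apply: eq_bigr => c _; rewrite formC form_simple.
have ay' a : a \in Pi -> form D (coV a) y = L / 2 * Y a.
  move=> ha; rewrite formC /y form_suml /Y rmorph_sum big_distrr /=.
  rewrite big_seq [RHS]big_seq; apply: eq_bigr => c hc; rewrite form_simple ?sPi //.
  by congr (_ / 2 * _); rewrite -(nth_index 0 hc) path_lsq // index_mem.
have X_le0 a : a \in ls -> X a <= 0.
  move=> ha; rewrite lerz0 big_seq; apply: sumr_le0 => c hc.
  apply: (simple_pairing_le0 (lsPi _ ha) (sPi _ hc)).
  by apply: contraNneq (disj a ha) => ->.
have t_ge0 a : a \in ls -> 0 <= t a.
  by move=> /X_le0; rewrite /t; lra.
have az a : a \in ls -> form D (coV a) z <= t a * lsq R D a.
  move=> ha; rewrite formC /z form_suml (bigD1_seq a) //= formZl -/(lsq R D a) gerDl.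
  rewrite big_seq_cond; apply: sumr_le0 => c /andP[hc ca].
  rewrite formZl; apply: mulr_ge0_le0; first exact: t_ge0.
  rewrite form_simple ?lsPi //; apply: mulr_ge0_le0.
    by rewrite divr_ge0 // ltW // la ?lsPi.
  by rewrite lerz0 simple_pairing_le0 ?lsPi.
have coef_rho a : a \in Pi -> form D (coV a) rho = lsq R D a / 2.
  move=> ha; have := form_coroot rho (Pi_root hPi ha); rewrite hrho // mulr1 => <-.
  by field.
have pos : 0 < form D (y + z) (y + z).
  apply: (@form_gt0 _ rho); rewrite gt_eqF // formDl.
  apply: ltr_wpDr.
    rewrite form_suml big_seq; apply: sumr_ge0 => a ha; rewrite formZl coef_rho ?lsPi //.
    by apply: mulr_ge0; [apply: t_ge0 | rewrite divr_ge0 // ltW // la ?lsPi].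
  rewrite form_suml; have hd : nth 0 s 0 \in s by apply: mem_nth.
  rewrite (bigD1_seq _ hd) ?path_uniq //=; apply: ltr_pwDl.
    by rewrite coef_rho ?sPi // divr_gt0.
  rewrite big_seq_cond; apply: sumr_ge0 => a /andP[ha _].
  by rewrite coef_rho ?sPi // divr_ge0 // ltW // la ?sPi.
have zy : form D z y = \sum_(a <- ls) - (L / 4 * (X a * Y a)).
  rewrite /z form_suml big_seq [RHS]big_seq; apply: eq_bigr => a ha.
  by rewrite formZl ay' ?lsPi // /t; field.
have zz : form D z z <= \sum_(a <- ls) L / 4 * (X a * Y a).
  rewrite {1}/z form_suml big_seq [leRHS]big_seq; apply: ler_sum => a ha.
  rewrite formZl; apply: le_trans (ler_wpM2l (t_ge0 a ha) (az a ha)) _.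
  have := ay a (lsPi a ha); rewrite ay' ?lsPi // /t => e.
  by have -> : L / 4 * (X a * Y a) = X a * (L / 2 * Y a) / 2; [field | rewrite e; lra].
move: pos; rewrite formDl !formDr yE (formC D y z) zy sumrN => pos.
have : 0 < L * (1 - (\sum_(a <- ls) X a * Y a) / 4).
  by move: zz pos; rewrite -!mulr_sumr; lra.
rewrite pmulr_rgt0 // subr_gt0 ltr_pdivrMr // mul1r /X /Y.
under eq_bigr do rewrite -rmorphM.
by rewrite -rmorph_sum -[4]/(4%:~R) ltr_int.
Qed.

End Subdiagram.

(** * Diagrams that are not of type A *)

Section Classification.
Context (R : realType) (n : nat) (D : root_datum n) (hred : reduced D).
Context (hirr : irreducible D) (Pi : seq 'rV[int]_n) (hPi : is_base D Pi).
Implicit Types (a b c : 'rV[int]_n) (s ls : seq 'rV[int]_n).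
Local Notation N a b := (pairing a (coroot D b)).
Local Notation path := (simply_laced_path D).

Definition nonA_cartans := [:: cartan_BC (-2) (-1); cartan_BC (-1) (-2); cartan_D;
  cartan_F (-2) (-1); cartan_F (-1) (-2)].

Definition has_nonA_subdiagram := exists bs M, [/\ size bs = 4%N, uniq bs,
  {subset bs <= Pi}, M \in nonA_cartans &
  forall i j, (i < 4)%N -> (j < 4)%N -> N (nth 0 bs i) (nth 0 bs j) = cart M i j].

Lemma adjacent_sym a b : a \in Pi -> b \in Pi -> (N a b == 0) = (N b a == 0).
Proof. by move=> ha hb; rewrite (pairing_eq0_sym R) // (Pi_root hPi). Qed.

Lemma adjacent_lt0 a b : a \in Pi -> b \in Pi -> a != b -> N a b != 0 -> N a b <= -1.
Proof. by move=> ha hb ab n0; have := simple_pairing_le0 R hred hPi ha hb ab; lia. Qed.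

Lemma nonadjacent a b : a \in Pi -> b \in Pi -> N a b = 0 -> N b a = 0.
Proof. by move=> ha hb /eqP; rewrite adjacent_sym // => /eqP. Qed.

Lemma diag2 a : a \in Pi -> N a a = 2.
Proof. by move=> /(Pi_root hPi)/pairing_coroot. Qed.

Lemma path1 a : a \in Pi -> path [:: a].
Proof. by move=> ha [|i] [|j] //= _ _; apply: diag2. Qed.

Lemma path_cons a s : a \in Pi -> {subset s <= Pi} -> path s -> (0 < size s)%N ->
  N a (nth 0 s 0) = -1 -> N (nth 0 s 0) a = -1 ->
  (forall i, (0 < i < size s)%N -> N a (nth 0 s i) = 0) -> path (a :: s).
Proof.
move=> ha sPi hs s0 n1 n2 n0; have hz i : (0 < i < size s)%N -> N (nth 0 s i) a = 0.
  by move=> hi; apply: nonadjacent (n0 i hi) => //; apply/sPi/mem_nth; case/andP: hi.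
move=> [|i] [|j] /=; rewrite ?ltnS.
- by move=> _ _; apply: diag2.
- by move=> _ hj; case: j hj => [|j] hj //; rewrite n0.
- by move=> hi _; case: i hi => [|i] hi //; rewrite hz.
- by move=> hi hj; rewrite hs // eqSS.
Qed.

Lemma rev_index m i j : (i < m)%N -> (j < m)%N ->
  [/\ (m - i.+1 < m)%N, (m - i.+1 == m - j.+1)%N = (i == j) &
      ((m - i.+1).+1 == (m - j.+1))%N = (j.+1 == i)].
Proof. by move=> hi hj; split; [lia | apply/eqP/eqP; lia | apply/eqP/eqP; lia]. Qed.

Lemma path_rev s : path s -> path (rev s).
Proof.
move=> hs i j; rewrite !size_rev => hi hj; rewrite !nth_rev //.
have [lti eij sij] := rev_index hi hj; have [ltj _ sji] := rev_index hj hi.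
by rewrite hs // eij sij sji orbC.
Qed.

(** Two neighbours on the path would contribute at least [(-2) * (-2)] to
    [branch_bound]. *)
Lemma no_cycle s a c d : {subset s <= Pi} -> path s -> a \in Pi -> a \notin s ->
  c \in s -> d \in s -> c != d -> N a c != 0 -> N a d = 0.
Proof.
move=> sPi hs ha as_ hc hd cd ac; apply/eqP/negPn/negP => ad.
have us := path_uniq hPi sPi hs.
have neq b : b \in s -> a != b by move=> hb; apply: contraNneq as_ => ->.
have s_gt0 : (0 < size s)%N by case: (s) hc.
have disj b : b \in [:: a] -> b \notin s by rewrite inE => /eqP ->.
have sub : {subset [:: a] <= Pi} by move=> b; rewrite inE => /eqP ->.
have := branch_bound R hred hPi sPi hs s_gt0 (ls := [:: a]) isT sub disj.
rewrite big_seq1.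
have le2 (F : 'rV[int]_n -> int) : (forall b, b \in s -> F b <= 0) -> F c <= -1 -> F d <= -1 ->
    \sum_(b <- s) F b <= -2.
  move=> F0 Fc Fd; rewrite (bigD1_seq c) //= -big_filter (bigD1_seq d) ?filter_uniq //=.
    have rest : \sum_(b <- [seq b <- s | b != c] | b != d) F b <= 0.
      by rewrite big_seq_cond; apply: sumr_le0 => b /andP[]; rewrite mem_filter => /andP[_ /F0].
    exact: lerD Fc (lerD Fd rest).
  by rewrite mem_filter hd eq_sym cd.
have neg b : b \in s -> N a b != 0 -> N a b <= -1 /\ N b a <= -1.
  move=> hb ab; have hbPi := sPi b hb; split; first by apply: adjacent_lt0 => //; apply: neq.
  apply: adjacent_lt0 => //; first by rewrite eq_sym neq.
  by rewrite -adjacent_sym.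
have [c1 c2] := neg c hc ac; have [d1 d2] := neg d hd ad.
have X : \sum_(b <- s) N a b <= -2.
  apply: (le2 (fun b => N a b)) c1 d1 => b hb.
  by apply: (simple_pairing_le0 R hred hPi ha (sPi b hb)); apply: neq.
have Y : \sum_(b <- s) N b a <= -2.
  apply: (le2 (fun b => N b a)) c2 d2 => b hb.
  by apply: (simple_pairing_le0 R hred hPi (sPi b hb) ha); rewrite eq_sym neq.
by nia.
Qed.

Lemma star_bound c ls : c \in Pi -> uniq ls -> {subset ls <= Pi} -> c \notin ls ->
  \sum_(a <- ls) N a c * N c a < 4.
Proof.
move=> hc uls lsPi cls; have sub : {subset [:: c] <= Pi} by move=> b; rewrite inE => /eqP ->.
have disj a : a \in ls -> a \notin [:: c].
  by move=> ha; rewrite inE; apply: contraNneq cls => <-.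
have := branch_bound R hred hPi sub (path1 hc) isT uls lsPi disj.
rewrite (_ : \sum_(a <- ls) _ = \sum_(a <- ls) N a c * N c a) //.
by apply: eq_bigr => a _; rewrite !big_seq1.
Qed.

Lemma bond1 (m k : int) : m <= -1 -> k <= -1 -> m * k < 2 -> m = -1 /\ k = -1.
Proof. by move=> m1 k1 mk; split; nia. Qed.

Lemma bond2 (m k : int) : m <= -1 -> k <= -1 -> 2 <= m * k -> m * k < 3 ->
  (m = -2 /\ k = -1) \/ (m = -1 /\ k = -2).
Proof.
move=> m1 k1 mk2 mk3; have [m1'|m2] : m = -1 \/ m = -2 by nia.
  by right; split=> //; move: mk2 mk3; rewrite m1'; lia.
by left; split=> //; move: mk2 mk3; rewrite m2; lia.
Qed.

Lemma adjacent2 a b : a \in Pi -> b \in Pi -> a != b -> N a b != 0 ->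
  N a b <= -1 /\ N b a <= -1.
Proof.
move=> ha hb ab n0; split; first exact: adjacent_lt0.
by apply: adjacent_lt0; rewrite -1?adjacent_sym // eq_sym.
Qed.

Lemma path_step s i : path s -> (i.+1 < size s)%N ->
  N (nth 0 s i) (nth 0 s i.+1) = -1 /\ N (nth 0 s i.+1) (nth 0 s i) = -1.
Proof.
move=> hs hi; have hi' := ltnW hi; rewrite !hs // eqxx orbT /= (ltn_eqF (ltnSn i)).
by rewrite (gtn_eqF (ltnSn i)).
Qed.

Lemma path_far s i j : path s -> (i.+1 < j < size s)%N ->
  N (nth 0 s i) (nth 0 s j) = 0 /\ N (nth 0 s j) (nth 0 s i) = 0.
Proof.
move=> hs /andP[ij hj]; have hi : (i < size s)%N by lia.
have [e1 e2 e3 e4] : [/\ (i == j) = false, (i.+1 == j) = false,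
    (j.+1 == i) = false & (j == i) = false] by split; apply/eqP; lia.
by rewrite !hs // e1 e2 e3 e4.
Qed.

Lemma subset4 a b c d : a \in Pi -> b \in Pi -> c \in Pi -> d \in Pi ->
  {subset [:: a; b; c; d] <= Pi}.
Proof. by move=> ? ? ? ? x; rewrite !inE => /or4P[] /eqP ->. Qed.

(** With three neighbours at a node, [branch_bound] leaves room for simple bonds only:
    this is type D. *)
Lemma interior_branch s i a : {subset s <= Pi} -> path s -> (0 < i)%N ->
  (i.+1 < size s)%N -> a \in Pi -> a \notin s -> N a (nth 0 s i) != 0 ->
  has_nonA_subdiagram.
Proof.
case: i => // i sPi hs _ i2 ha as_ ai.
have us := path_uniq hPi sPi hs.
have i1 := ltnW i2; have i0 := ltnW i1.
have mem k : (k < size s)%N -> nth 0 s k \in s by apply: mem_nth.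
have neq k : (k < size s)%N -> a != nth 0 s k.
  by move=> hk; apply: contraNneq as_ => ->; apply: mem.
have nz k : (k < size s)%N -> i.+1 != k -> N a (nth 0 s k) = 0 /\ N (nth 0 s k) a = 0.
  move=> hk ki; have e : N a (nth 0 s k) = 0.
    by apply: (no_cycle sPi hs ha as_ (mem _ i1) (mem _ hk)) ai; rewrite nth_uniq.
  by split=> //; apply: nonadjacent e => //; apply/sPi/mem.
have ne1 : i.+1 != i by rewrite gtn_eqF.
have ne2 : i.+1 != i.+2 by rewrite ltn_eqF.
have [ap pa] := nz i i0 ne1; have [aq qa] := nz i.+2 i2 ne2.
have [ac ca] := adjacent2 ha (sPi _ (mem _ i1)) (neq _ i1) ai.
have [pc cp] := path_step hs i1; have [cq qc] := path_step hs i2.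
have [pq qp] := path_far hs (introT andP (conj (ltnSn i.+1) i2)).
have [np nc nq] := And3 (neq _ i0) (neq _ i1) (neq _ i2).
have [hp hc hq] := And3 (sPi _ (mem _ i0)) (sPi _ (mem _ i1)) (sPi _ (mem _ i2)).
have e_pc : (nth 0 s i == nth 0 s i.+1) = false by rewrite nth_uniq // ltn_eqF.
have e_pq : (nth 0 s i == nth 0 s i.+2) = false by rewrite nth_uniq // ltn_eqF.
have e_cq : (nth 0 s i.+1 == nth 0 s i.+2) = false by rewrite nth_uniq // ltn_eqF.
move: (nth 0 s i) (nth 0 s i.+1) (nth 0 s i.+2) ap pa aq qa ac ca pc cp cq qc pq qp np nc nq
  hp hc hq e_pc e_pq e_cq => p c q ap pa aq qa ac ca pc cp cq qc pq qp np nc nq hp hc hq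
  e_pc e_pq e_cq.
have [acN caN] : N a c = -1 /\ N c a = -1.
  apply: bond1 => //; have := @star_bound c [:: p; q; a] hc.
  rewrite /= !inE e_pq ![_ == a]eq_sym (negPf np) (negPf nq) /= ![c == _]eq_sym e_pc.
  rewrite (negPf nc) eq_sym e_cq /= !big_cons big_nil pc cp cq qc addr0.
  move=> /(_ isT) bound; have {}bound := bound _ isT.
  have : {subset [:: p; q; a] <= Pi} by move=> x; rewrite !inE => /or3P[] /eqP ->.
  by move=> /bound; clear; lia.
exists [:: c; p; q; a], cartan_D; split=> //.
- rewrite /= !inE ![c == _]eq_sym e_pc eq_sym e_cq (negPf nc) e_pq.
  by rewrite ![_ == a]eq_sym (negPf np) (negPf nq).
- exact: subset4.
have dg := (diag2 hp, diag2 hc, diag2 hq, diag2 ha).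
by move=> [|[|[|[|?]]]] [|[|[|[|?]]]] // _ _; rewrite /cart /= ?dg ?ap ?pa ?aq ?qa ?acN ?caN
  ?pc ?cp ?cq ?qc ?pq ?qp.
Qed.

Lemma exists_outside s : (size s < size Pi)%N -> exists2 b, b \in Pi & b \notin s.
Proof.
move=> lt; apply/hasP; apply: contraTT lt => /hasPn h; rewrite -leqNgt.
by apply: uniq_leq_size => [|b /h /negPn //]; have [] := hPi.
Qed.

Lemma adjacent_outside s a : a \in Pi -> a \in s -> (size s < size Pi)%N ->
  exists b c, [/\ b \in Pi, b \notin s, c \in Pi, c \in s & N b c != 0].
Proof.
move=> ha as_ /exists_outside[b hb bs].
have [||c [d [hc hd cs ds cd]]] := base_connected R hred hPi (P := mem s) hirr.
- by exists a.
- by exists b.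
by exists d, c; split=> //; rewrite adjacent_sym.
Qed.

(** By maximality the bond from the end of the path to [a] is multiple, and
    [branch_bound] makes it double as soon as one more node is attached.  A path
    with at least three nodes then gives type B or C.  On a path with two nodes,
    the only place left for a fourth node is beyond [a], which gives type F.  On
    a path with one node all bonds are multiple, and a third node has no place. *)
Lemma end_branch s a : {subset s <= Pi} -> path s -> (0 < size s)%N ->
  (forall s', {subset s' <= Pi} -> path s' -> (size s' <= size s)%N) ->
  (4 <= size Pi)%N -> a \in Pi -> a \notin s -> N a (nth 0 s 0) != 0 ->
  has_nonA_subdiagram.
Proof.
move=> sPi hs s0 smax size4 ha as_ a0.
have us := path_uniq hPi sPi hs.
have mem k : (k < size s)%N -> nth 0 s k \in s by apply: mem_nth.
have neq b k : b \notin s -> (k < size s)%N -> b != nth 0 s k.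
  by move=> bs hk; apply: contraNneq bs => ->; apply: mem.
have nz b i k : b \in Pi -> b \notin s -> (i < size s)%N -> (k < size s)%N -> i != k ->
    N b (nth 0 s i) != 0 -> N b (nth 0 s k) = 0.
  move=> hb bs hi hk ik; apply: (no_cycle sPi hs hb bs (mem _ hi) (mem _ hk)).
  by rewrite nth_uniq.
have hd := sPi _ (mem _ s0).
(* Stated for a path [t] of the same size, so as to apply to the reversed path too. *)
have multiple b t : b \in Pi -> b \notin t -> {subset t <= Pi} -> path t ->
    size t = size s -> N b (nth 0 t 0) != 0 -> 2 <= N b (nth 0 t 0) * N (nth 0 t 0) b.
  move=> hb bt tPi ht tsz b0; have t0 : (0 < size t)%N by rewrite tsz.
  have ht0 := tPi _ (mem_nth 0 t0).
  have bt0 : b != nth 0 t 0 by apply: contraNneq bt => ->; apply: mem_nth.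
  have [b1 b2] := adjacent2 hb ht0 bt0 b0.
  rewrite leNgt; apply/negP => lt2; have [n1 n2] := bond1 b1 b2 lt2.
  have pt : path (b :: t).
    apply: path_cons => // i /andP[i_gt0 hi].
    apply: (no_cycle tPi ht hb bt (mem_nth 0 t0) (mem_nth 0 hi)) b0.
    by rewrite nth_uniq ?(path_uniq hPi tPi ht) // ltn_eqF.
  have sub : {subset b :: t <= Pi} by move=> x; rewrite inE => /orP[/eqP ->|/tPi].
  by have := smax _ sub pt; rewrite /= tsz ltnn.
have a0s := neq a 0%N as_ s0.
have [a1 a2] := adjacent2 ha hd a0s a0.
have mult_a := multiple a s ha as_ sPi hs erefl a0.
have star2 c b d : c \in Pi -> b \in Pi -> d \in Pi -> c != b -> c != d -> b != d ->
    N b c * N c b + N d c * N c d < 4.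
  move=> hc hb hd' cb cd bd; have := @star_bound c [:: b; d] hc.
  rewrite /= !inE bd (negPf cb) (negPf cd) !big_cons big_nil addr0.
  by apply=> // x; rewrite !inE => /orP[] /eqP ->.
case: (ltngtP (size s) 2) => [s_lt2|s_gt2|s_eq2].
- have s1 : size s = 1%N by apply/eqP; rewrite eqn_leq s0 -ltnS s_lt2.
  have [c sE] : exists c, s = [:: c] by case: (s) s1 => // c [] // _; exists c.
  move: sPi hs smax as_ a0 hd mult_a multiple a1 a2 a0s; rewrite {}sE /=.
  move=> sPi hs smax as_ a0 hc mult_a multiple a1 a2 ac.
  have lt3 : (size [:: c; a] < size Pi)%N by apply: leq_trans size4.
  have [b [d [hb bca _]]] := adjacent_outside ha (mem_last c [:: a]) lt3.
  move: bca; rewrite !inE negb_or => /andP[bc ba] /orP[]/eqP -> bd.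
    have mult_b : 2 <= N b c * N c b by apply: (multiple b [:: c]); rewrite // inE.
    have := star2 c b a hc hb ha; rewrite eq_sym bc eq_sym ac ba => /(_ isT isT isT).
    by move: mult_a mult_b; clear; lia.
  have mult_b : 2 <= N b a * N a b.
    apply: (multiple b [:: a]); rewrite ?inE //; last exact: path1.
    by move=> x; rewrite inE => /eqP ->.
  have := star2 a b c ha hb hc; rewrite eq_sym ba ac bc => /(_ isT isT isT).
  by move: mult_a mult_b; clear; lia.
- have [s1 s2] : (1 < size s)%N /\ (2 < size s)%N by split; [apply: ltnW | ].
  have [e01 e10] := path_step hs s1; have [e12 e21] := path_step hs s2.
  have [e02 e20] := path_far hs (introT andP (conj (ltnSn 1) s2)).
  have az1 := nz a 0%N 1%N ha as_ s0 s1 isT a0; have az2 := nz a 0%N 2%N ha as_ s0 s2 isT a0.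
  have [h1 h2] := (sPi _ (mem _ s1), sPi _ (mem _ s2)).
  have [na1 na2] := (neq a 1%N as_ s1, neq a 2%N as_ s2).
  have [z1 z2] := (nonadjacent ha h1 az1, nonadjacent ha h2 az2).
  have [u01 u02 u12] : [/\ nth 0 s 0 != nth 0 s 1, nth 0 s 0 != nth 0 s 2 &
    nth 0 s 1 != nth 0 s 2] by rewrite !nth_uniq.
  have lt3 : N a (nth 0 s 0) * N (nth 0 s 0) a < 3.
    have := star2 _ _ _ hd ha h1; rewrite eq_sym a0s u01 na1 e01 e10.
    by move=> /(_ isT isT isT); clear; lia.
  have d4 := (diag2 ha, diag2 hd, diag2 h1, diag2 h2).
  exists [:: a; nth 0 s 0; nth 0 s 1; nth 0 s 2].
  exists (cartan_BC (N a (nth 0 s 0)) (N (nth 0 s 0) a)); split=> //.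
  + by rewrite /= !inE !negb_or a0s na1 na2 u01 u02 u12.
  + exact: subset4.
  + by case: (bond2 a1 a2 mult_a lt3) => -[-> ->].
  + move=> [|[|[|[|?]]]] [|[|[|[|?]]]] // _ _; rewrite /cart /= ?d4 //.
- have [c [d sE]] : exists c d, s = [:: c; d].
    by case: (s) s_eq2 => [|c [|d []]] // _; exists c, d.
  move: sPi hs smax as_ a0 hd mult_a multiple a1 a2 a0s us nz; rewrite {}sE /=.
  move=> sPi hs smax as_ a0 hc mult_a multiple a1 a2 ac us nz.
  have hd : d \in Pi by apply: sPi; rewrite !inE eqxx orbT.
  have cd : c != d by move: us; rewrite /= inE andbT.
  have [e01 e10] := path_step hs (ltnSn 1).
  have az : N a d = 0 := nz a 0%N 1%N ha as_ isT isT isT a0.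
  have za := nonadjacent ha hd az.
  have ad : a != d by move: as_; rewrite !inE negb_or => /andP[].
  have lt3 : N a c * N c a < 3.
    have := star2 _ _ _ hc ha hd; rewrite eq_sym ac cd ad e01 e10.
    by move=> /(_ isT isT isT); clear; lia.
  have lt4 : (size [:: c; d; a] < size Pi)%N by [].
  have [b [e [hb bcda _]]] := adjacent_outside ha (mem_last c [:: d; a]) lt4.
  move: bcda; rewrite !inE !negb_or => /and3P[bc bd ba] e_in be.
  have bs : b \notin [:: c; d] by rewrite !inE negb_or bc.
  have bc0 : N b c = 0.
    apply/eqP/negPn/negP => bc0; have mult_b := multiple b [:: c; d] hb bs sPi hs erefl bc0.
    have := star2 _ _ _ hc ha hb; rewrite eq_sym ac eq_sym bc eq_sym ba => /(_ isT isT isT).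
    by move: mult_a mult_b => /=; clear; lia.
  have bd0 : N b d = 0.
    apply/eqP/negPn/negP => bd0.
    have bs' : b \notin [:: d; c] by rewrite !inE negb_or bd.
    have sub' : {subset [:: d; c] <= Pi} by move=> x; rewrite !inE => /orP[]/eqP ->.
    have := multiple b [:: d; c] hb bs' sub' (path_rev hs) erefl bd0 => /= mult_b.
    have uab : uniq [:: a; b] by rewrite /= inE eq_sym ba.
    have subab : {subset [:: a; b] <= Pi} by move=> x; rewrite !inE => /orP[]/eqP ->.
    have disj x : x \in [:: a; b] -> x \notin [:: c; d].
      by rewrite [x \in _]inE => /orP[/eqP ->|]; rewrite // inE => /eqP ->.
    have := branch_bound R hred hPi sPi hs isT uab subab disj.
    by rewrite !big_cons !big_nil az za bc0 (nonadjacent hb hc bc0) !addr0 !add0r;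
      move: mult_a mult_b; clear; lia.
  have ba0 : N b a != 0.
    by move: e_in be => /or3P[]/eqP -> //; rewrite ?bc0 ?bd0 eqxx.
  have [b1 b2] := adjacent2 hb ha ba ba0.
  have [ba1 ab1] : N b a = -1 /\ N a b = -1.
    apply: bond1 => //; have := star2 _ _ _ ha hb hc; rewrite eq_sym ba ac bc.
    by move=> /(_ isT isT isT); move: mult_a; clear; lia.
  have [cb db] := (nonadjacent hb hc bc0, nonadjacent hb hd bd0).
  have d4 := (diag2 ha, diag2 hb, diag2 hc, diag2 hd).
  exists [:: b; a; c; d], (cartan_F (N a c) (N c a)); split=> //.
  + by rewrite /= !inE !negb_or ba bc bd ac ad cd.
  + exact: subset4.
  + by case: (bond2 a1 a2 mult_a lt3) => -[-> ->].
  + by move=> [|[|[|[|?]]]] [|[|[|[|?]]]] // _ _; rewrite /cart /= ?d4.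
Qed.

(** Take a longest simply laced path.  It does not exhaust the base, which is not of
    type A, so by connectedness some other simple root is attached to it. *)
Lemma nonA_subdiagram : (4 <= size Pi)%N -> ~ is_type_A D Pi -> has_nonA_subdiagram.
Proof.
move=> size4 nonA; have [uPi _ _ _] := hPi.
pose P k := `[< exists s, [/\ {subset s <= Pi}, path s & size s = k] >].
have P0 : exists k, P k by exists 0%N; apply/asboolP; exists [::]; split=> // -[].
have Pbound k : P k -> (k <= size Pi)%N.
  move=> /asboolP[s [sPi hs <-]].
  exact: uniq_leq_size (path_uniq hPi sPi hs) sPi.
case: (ex_maxnP P0 Pbound) => k /asboolP[s [sPi hs sk]] kmax.
have smax s' : {subset s' <= Pi} -> path s' -> (size s' <= size s)%N.
  by move=> s'Pi hs'; rewrite sk; apply: kmax; apply/asboolP; exists s'.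
have us := path_uniq hPi sPi hs.
have lt_s : (size s < size Pi)%N.
  rewrite ltnNge; apply/negP => le; apply: nonA; exists s => //.
  by apply: uniq_perm => // x; have [_ ->] := uniq_min_size us sPi le.
have [a0 ha0] : exists a, a \in Pi by case: (Pi) size4 => // a ? _; exists a; apply: mem_head.
have s0 : (0 < size s)%N.
  apply: (smax [:: a0]); last exact: path1.
  by move=> x; rewrite inE => /eqP ->.
have hd : nth 0 s 0 \in s by apply: mem_nth.
have [a [c [ha as_ hc cs ac]]] := adjacent_outside (sPi _ hd) hd lt_s.
have ci := nth_index 0 cs; have hi : (index c s < size s)%N by rewrite index_mem.
move: ac; rewrite -ci; move: (index c s) hi => i hi ac.
have [i0|i_gt0] := posnP i.
  by apply: (@end_branch s a) => //; move: ac; rewrite i0.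
have [ilast|i_lt] := leqP (size s) i.+1; last first.
  exact: (@interior_branch s i a).
apply: (@end_branch (rev s) a); rewrite ?size_rev ?mem_rev ?nth_rev //.
- by move=> x; rewrite mem_rev => /sPi.
- exact: path_rev.
- by rewrite subn1 (_ : (size s).-1 = i) //; lia.
Qed.

End Classification.

(** * The theorem *)

Theorem theorem3 (R : realType) (n : nat) (D : root_datum n)
  (hred : reduced D) (hirr : irreducible D) :
  exists N : nat, forall (Pi : seq 'rV[int]_n) (h : 'rV[int]_n),
    is_base D Pi -> is_highest_root D Pi h ->
    (4 <= size Pi)%N -> ~ is_type_A D Pi ->
    forall mu : 'rV[int]_n,
      (forall a, a \in Pi -> N%:Z <= pairing a mu) ->
      Adm R D Pi h mu <> Perm R D Pi h mu.
Proof.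
(* Four coroots, each with a coefficient at most 10. *)
exists 40%N => Pi h hPi hh size4 nonA mu hmu.
have [bs [M [bs4 ubs bsPi hM cartE]]] := nonA_subdiagram R hred hirr hPi size4 nonA.
have [L [ps [qs [i [K cert]]]]] : exists L ps qs i K, deodhar_cert M L ps qs i K.
  move: hM; rewrite !inE => /or4P[|||/orP[]] /eqP ->; do 5 eexists.
  - exact: cert_B.
  - exact: cert_C.
  - exact: cert_D.
  - exact: cert_F1.
  - exact: cert_F2.
have mu40 a : a \in Pi -> 40 <= pairing a mu by move=> /hmu; lia.
exact: (cert_Adm_neq_Perm hred hPi bs4 ubs bsPi cartE hh cert mu40).
Qed.
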